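(* Let $M=(M_j)_{j\ge 0}$ be a sequence of real numbers that is increasing with $M_0=1$ and logarithmically convex. Assume that the local ring $\mathcal{E}_1(M)$ is quasianalytic and stable under derivation. Let $d\ge 1$ be an integer and consider a polynomial $$\varphi(x,y)=y^d+a_1(x)y^{d-1}+\cdots+a_d(x)$$ with $a_j\in\mathcal{E}_1(M)$ for $j=1,\ldots,d$. If $h$ is a germ of $C^\infty$ function at the origin in $\mathbb{R}$ such that $\varphi(x,h(x))=0$ (as a germ at the origin in $\mathbb{R}$), then $h$ belongs to $\mathcal{E}_1(M)$.
   Context: Functions and germs are complex-valued (this includes the real-valued ones). ''Increasing'' is meant in the wide sense, $M_j\le M_{j+1}$ for all $j$; ''logarithmically convex'' means that $M_{j+1}/M_j$ is an increasing (wide sense) function of $j$. $\mathcal{E}_1(M)$ denotes the set of germs $f$ of $C^\infty$ functions at the origin in $\mathbb{R}$ for which there exist a neighborhood $U$ of $0$ in $\mathbb{R}$ and positive constants $C,\sigma$ such that $|f^{(j)}(x)|\le C\sigma^j\, j!\,M_j$ for all integers $j\ge 0$ and all $x\in U$. It is a local ring. A $C^\infty$ germ is flat if it vanishes at the origin together with all its derivatives. $\mathcal{E}_1(M)$ is called quasianalytic if the only flat germ it contains is $0$ (by the Denjoy-Carleman theorem this is equivalent to $\sum_{j\ge 0}\frac{M_j}{(j+1)M_{j+1}}=\infty$). $\mathcal{E}_1(M)$ is stable under derivation if $f\in\mathcal{E}_1(M)$ implies $f'\in\mathcal{E}_1(M)$ (it is known that this is equivalent to $\sup_{j\ge 1}(M_{j+1}/M_j)^{1/j}<\infty$).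 *)

(* Defs.v *)
(* World: Stdlib reals with Coquelicot. *)
From Stdlib Require Import Factorial Reals.
From Coquelicot Require Import Coquelicot.

Open Scope R_scope.

(* Germs at the origin of R are represented by functions [R -> C]; only the
   values near 0 matter, and equality of germs is [germ_eq].  All the predicates
   on germs below are invariant under [germ_eq]. *)
Definition germ_eq (f g : R -> C) : Prop := locally 0 (fun x => f x = g x).

(* Differentiation with respect to a real variable acts separately on the real
   and the imaginary part.  [Derive_n] is a total operator, so [CDerive_n f j x]
   is the j-th derivative only where it exists, e.g. near 0 for a smooth germ. *)
Definition CDerive_n (f : R -> C) (j : nat) (x : R) : C :=
  (Derive_n (fun t => Re (f t)) j x, Derive_n (fun t => Im (f t)) j x).

Definition ex_CDerive_n (f : R -> C) (j : nat) (x : R) : Prop :=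
  ex_derive_n (fun t => Re (f t)) j x /\ ex_derive_n (fun t => Im (f t)) j x.

(* One neighborhood of 0 serves all orders of differentiation. *)
Definition smooth_germ (f : R -> C) : Prop :=
  locally 0 (fun x => forall j : nat, ex_CDerive_n f j x).

Definition flat_germ (f : R -> C) : Prop :=
  forall j : nat, CDerive_n f j 0 = RtoC 0.

Definition class_E1 (M : nat -> R) (f : R -> C) : Prop :=
  smooth_germ f /\
  exists (U : R -> Prop) (A sigma : R),
    locally 0 U /\ 0 < A /\ 0 < sigma /\
    forall (j : nat) (x : R), U x ->
      Cmod (CDerive_n f j x) <= A * sigma ^ j * INR (fact j) * M j.

Definition increasing_seq (M : nat -> R) : Prop :=
  forall j : nat, M j <= M (S j).

Definition log_convex (M : nat -> R) : Prop :=
  increasing_seq (fun j => M (S j) / M j).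

Definition quasianalytic (M : nat -> R) : Prop :=
  forall f : R -> C, class_E1 M f -> flat_germ f -> germ_eq f (fun _ => RtoC 0).

Definition stable_under_derivation (M : nat -> R) : Prop :=
  forall f : R -> C, class_E1 M f -> class_E1 M (CDerive_n f 1).

(* y^d + a_1(x) y^(d-1) + ... + a_d(x); the values of [a] outside 1..d are not
   used. *)
Definition monic_poly (d : nat) (a : nat -> R -> C) (x : R) (y : C) : C :=
  (Cpow y d + sum_n_m (fun j => Cmult (a j x) (Cpow y (d - j))) 1 d)%C.

(* Main.v *)
Require Import Defs.
From Stdlib Require Import Factorial Reals Lra Lia Classical.
From Coquelicot Require Import Coquelicot.
Open Scope R_scope.

(** The proof combines an algebraic reduction with one estimate.

    Estimate.  The jet of f at x is the sequence of the f^(n)(x)/n!; jets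
    multiply by the Cauchy product.  Log-convexity and M_0 = 1 give
    M_i M_j <= M_(i+j), so the weighted truncated norms
      sum_(n <= N) |a_n| rho^n / M_n
    are submultiplicative, and f belongs to the class exactly when, for some
    rho > 0, these norms of its jets are bounded uniformly in N and in x near 0.
    This turns the ring structure of the class into a triviality, and it also
    settles equations in fixed-point form w(x) = c + x F(x, w(x)), with F
    polynomial in w over the class [E1_fixed_point]: the norm s(rho) of the jet of
    w satisfies s <= |c| + (|x| + rho) Psi(s) with Psi independent of N and x, and
    since s is continuous in rho and starts below |c| + 1, for small x and rho it
    never reaches that value.

    Reduction.  By quasianalyticity a flat element of the class is 0, and any
    non-flat smooth germ is x^k times a germ that does not vanish.  Among the
    nonzero polynomials P over the class such that P(x, h(x)) is flat, take one
    of least degree.  Pseudo-division of the given polynomial by P, repeated,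
    shows that P(x, h(x)) vanishes and not only that it is flat [minimal_root];
    minimality also shows that P_y(x, h(x)) has a finite order k of vanishing
    [minimal_derivative].

    Link.  Write h = p + x^(k+1) w, with p a Taylor polynomial of h and w smooth.
    The second order expansion of P(x, p + x^(k+1) w) has P(x, p) divisible by
    x^(2k+1) and P_y(x, p) by exactly x^k.  Stability under derivation is what
    makes the quotients of these divisions stay in the class (Hadamard's lemma,
    [E1_divide]); after division by x^(2k+1) the equation for w takes the
    fixed-point form above [E1_simple_root]. *)

(** * Jets of complex-valued smooth germs *)

Definition is_Cderive (f : R -> C) (x : R) (l : C) : Prop :=
  is_derive (fun t => Re (f t)) x (Re l) /\ is_derive (fun t => Im (f t)) x (Im l).

Definition jet (f : R -> C) (n : nat) (x : R) : C :=
  (/ INR (fact n) * Derive_n (fun t => Re (f t)) n x,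
   / INR (fact n) * Derive_n (fun t => Im (f t)) n x).

(** The normalization by n! of [jet] is what puts the factor n+1 here and makes the
    Cauchy product the jet of a product. *)
Definition tower_at (F : nat -> R -> C) (x : R) : Prop :=
  forall n, is_Cderive (F n) x (RtoC (INR (S n)) * F (S n) x)%C.

Definition smooth (f : R -> C) : Prop := locally 0 (tower_at (jet f)).

Lemma jet_0 f x : jet f 0 x = f x.
Proof. unfold jet; simpl. rewrite Rinv_1, !Rmult_1_l. now destruct (f x). Qed.

Lemma CDerive_n_jet f n x : CDerive_n f n x = (RtoC (INR (fact n)) * jet f n x)%C.
Proof.
  unfold CDerive_n, jet, Cmult; simpl.
  assert (INR (fact n) <> 0) by apply INR_fact_neq_0.
  f_equal; field; auto.
Qed.

Lemma is_Cderive_unique f x l : is_Cderive f x l ->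
  l = (Derive (fun t => Re (f t)) x, Derive (fun t => Im (f t)) x).
Proof.
  intros [H1 H2]. apply injective_projections; symmetry; now apply is_derive_unique.
Qed.

Lemma is_Cderive_ext_loc f g x l : locally x (fun y => f y = g y) ->
  is_Cderive f x l -> is_Cderive g x l.
Proof.
  intros H [H1 H2]; split.
  - eapply is_derive_ext_loc; [|exact H1]. eapply filter_imp; [|exact H].
    now intros y ->.
  - eapply is_derive_ext_loc; [|exact H2]. eapply filter_imp; [|exact H].
    now intros y ->.
Qed.

Lemma is_Cderive_plus f g x l m : is_Cderive f x l -> is_Cderive g x m ->
  is_Cderive (fun t => f t + g t)%C x (l + m)%C.
Proof.
  intros [H1 H2] [H3 H4]; split; simpl.
  - exact (is_derive_plus _ _ _ _ _ H1 H3).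
  - exact (is_derive_plus _ _ _ _ _ H2 H4).
Qed.

Lemma is_Cderive_mult f g x l m : is_Cderive f x l -> is_Cderive g x m ->
  is_Cderive (fun t => f t * g t)%C x (l * g x + f x * m)%C.
Proof.
  intros [H1 H2] [H3 H4].
  assert (Hm : forall u v a b, is_derive u x a -> is_derive v x b ->
     is_derive (fun t => u t * v t) x (a * v x + u x * b)).
  { intros u v a b Hu Hv. apply (is_derive_mult u v x a b Hu Hv). exact Rmult_comm. }
  split; unfold Cmult, Cplus; cbn [Re Im fst snd].
  - evar_last. apply (is_derive_minus (fun t => Re (f t) * Re (g t)) (fun t => Im (f t) * Im (g t)));
      apply Hm; eassumption.
    unfold minus, plus, opp; simpl. unfold Re, Im. ring.
  - evar_last. apply (is_derive_plus (fun t => Re (f t) * Im (g t)) (fun t => Im (f t) * Re (g t)));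
      apply Hm; eassumption.
    unfold minus, plus, opp; simpl. unfold Re, Im. ring.
Qed.

Lemma is_Cderive_const c x : is_Cderive (fun _ => c) x 0%C.
Proof. split; simpl; apply (is_derive_const (_ : R)). Qed.

Lemma is_Cderive_id x : is_Cderive RtoC x 1%C.
Proof. split; simpl; [apply (is_derive_id x) | apply (is_derive_const (0 : R))]. Qed.

Lemma is_Cderive_scal c f x l : is_Cderive f x l ->
  is_Cderive (fun t => c * f t)%C x (c * l)%C.
Proof.
  intros H. pose proof (is_Cderive_mult _ _ _ _ _ (is_Cderive_const c x) H) as G.
  simpl in G. replace (c * l)%C with (0 * f x + c * l)%C by ring. exact G.
Qed.

Lemma jet_S f n x : jet f (S n) x =
  (RtoC (/ INR (S n)) * (Derive (fun t => Re (jet f n t)) x, Derive (fun t => Im (jet f n t)) x))%C.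
Proof.
  unfold jet. cbn [Re Im fst snd Derive_n]. rewrite !Derive_scal.
  rewrite fact_simpl, mult_INR.
  assert (INR (S n) <> 0) by (apply not_0_INR; lia).
  assert (INR (fact n) <> 0) by apply INR_fact_neq_0.
  unfold Cmult, RtoC; cbn [fst snd]. f_equal; field; auto.
Qed.

Lemma Cinv_INR_S n z : (RtoC (/ INR (S n)) * (RtoC (INR (S n)) * z))%C = z.
Proof.
  rewrite Cmult_assoc, <- RtoC_mult, Rinv_l, Cmult_1_l; auto. apply not_0_INR; lia.
Qed.

Lemma jet_tower_near F f x :
  locally x (tower_at F) -> locally x (fun y => f y = F O y) ->
  forall n, locally x (fun y => jet f n y = F n y).
Proof.
  intros HF Hf; induction n.
  - revert Hf; apply filter_imp; intros y <-. apply jet_0.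
  - generalize (filter_and _ _ HF (locally_locally _ _ IHn)).
    apply filter_imp; intros y [Hy1 Hy2].
    rewrite jet_S, <- (is_Cderive_unique _ _ (RtoC (INR (S n)) * F (S n) y)%C).
    + apply Cinv_INR_S.
    + eapply is_Cderive_ext_loc; [|apply (Hy1 n)].
      revert Hy2; apply filter_imp; auto.
Qed.

(** Every jet below is computed by exhibiting a tower and appealing to uniqueness:
    the same neighborhood serves all orders at once. *)
Lemma jet_of_tower F f :
  locally 0 (tower_at F) -> locally 0 (fun y => f y = F O y) ->
  smooth f /\ locally 0 (fun y => forall n, jet f n y = F n y).
Proof.
  intros HF Hf.
  generalize (locally_locally _ _ (filter_and _ _ HF Hf)); intros H.
  assert (HJ : locally 0 (fun y => forall n, jet f n y = F n y)).
  { revert H; apply filter_imp; intros y Hy n.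
    apply (locally_singleton y (fun y => jet f n y = F n y)).
    apply jet_tower_near; revert Hy; apply filter_imp; intros z [? ?]; auto. }
  split; auto. unfold smooth.
  generalize (filter_and _ _ HF (locally_locally _ _ HJ)).
  apply filter_imp; intros y [Hy1 Hy2] n.
  rewrite (locally_singleton _ _ Hy2 (S n)).
  eapply is_Cderive_ext_loc; [|apply (Hy1 n)].
  revert Hy2; apply filter_imp; auto.
Qed.

Lemma smooth_germ_iff f : smooth_germ f <-> smooth f.
Proof.
  split; unfold smooth, smooth_germ; apply filter_imp; intros x H.
  - intros n. destruct (H (S n)) as [H1 H2]; simpl in H1, H2.
    apply Derive_correct in H1, H2.
    assert (INR (S n) <> 0) by (apply not_0_INR; lia).
    assert (INR (fact n) <> 0) by apply INR_fact_neq_0.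
    split; unfold jet; cbn [Re Im fst snd Derive_n Cmult RtoC];
      rewrite fact_simpl, mult_INR.
    + evar_last. apply (is_derive_scal _ x (/ INR (fact n)) _ H1). unfold Re, Im; field; auto.
    + evar_last. apply (is_derive_scal _ x (/ INR (fact n)) _ H2). unfold Re, Im; field; auto.
  - intros n. destruct n; [split; exact I|].
    destruct (H n) as [H1 H2].
    unfold jet in H1, H2; cbn [Re Im fst snd Cmult RtoC] in H1, H2.
    assert (INR (fact n) <> 0) by apply INR_fact_neq_0.
    split; simpl.
    + apply (ex_derive_ext (fun t => INR (fact n) *
        (/ INR (fact n) * Derive_n (fun u => Re (f u)) n t))).
      * intros t. match goal with |- ?a = ?b => change (@eq R a b) end. field; auto.
      * apply ex_derive_scal. eexists; exact H1.
    + apply (ex_derive_ext (fun t => INR (fact n) *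
        (/ INR (fact n) * Derive_n (fun u => Im (f u)) n t))).
      * intros t. match goal with |- ?a = ?b => change (@eq R a b) end. field; auto.
      * apply ex_derive_scal. eexists; exact H2.
Qed.

(** The Cauchy product, by recursion on a shift of the first factor, which is the
    recursion that both the Leibniz rule and the norm inequality follow. *)
Fixpoint conv (a b : nat -> C) (n : nat) : C :=
  match n with
  | O => (a O * b O)%C
  | S m => (a O * b (S m) + conv (fun i => a (S i)) b m)%C
  end.

Lemma conv_ext_l (a a' b : nat -> C) n : (forall i, a i = a' i) -> conv a b n = conv a' b n.
Proof.
  revert a a'; induction n; intros a a' H; simpl; rewrite H; auto.
  f_equal. now apply IHn.
Qed.

(** Leibniz rule for towers.  The induction shifts the first tower, whose
    derivatives then carry a factor i+1+s instead of i+1, hence the parameter s and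
    the extra term. *)
Lemma conv_derive (G : nat -> R -> C) x : tower_at G x -> forall n s (F : nat -> R -> C),
  (forall i, is_Cderive (F i) x (RtoC (INR (S (i + s))) * F (S i) x)%C) ->
  is_Cderive (fun t => conv (fun i => F i t) (fun i => G i t) n) x
    (RtoC (INR (S n)) * conv (fun i => F i x) (fun i => G i x) (S n)
     + RtoC (INR s) * conv (fun i => F (S i) x) (fun i => G i x) n)%C.
Proof.
  intros HG; induction n; intros s F HF.
  - simpl. pose proof (is_Cderive_mult _ _ _ _ _ (HF O) (HG O)) as H.
    replace (RtoC 1 * (F 0%nat x * G 1%nat x + F 1%nat x * G 0%nat x) +
             RtoC (INR s) * (F 1%nat x * G 0%nat x))%C
      with (RtoC (INR (S (0 + s))) * F 1%nat x * G 0%nat x +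
            F 0%nat x * (RtoC (INR 1) * G 1%nat x))%C; auto.
    change (0 + s)%nat with s. rewrite S_INR, RtoC_plus. simpl. ring.
  - assert (HF' : forall i, is_Cderive (fun t => F (S i) t) x (RtoC (INR (S (i + S s))) * F (S (S i)) x)%C).
    { intros i. replace (S (i + S s)) with (S (S i + s))%nat by lia. apply HF. }
    pose proof (is_Cderive_plus _ _ _ _ _ (is_Cderive_mult _ _ _ _ _ (HF O) (HG (S n)))
      (IHn (S s) (fun i => F (S i)) HF')) as H.
    cbn beta in H.
    match goal with |- is_Cderive _ _ ?r =>
      match type of H with is_Cderive _ _ ?r' => replace r with r'; [exact H|] end end.
    change (0 + s)%nat with s. cbn [conv].
    rewrite !S_INR, !RtoC_plus. ring.
Qed.

Lemma tower_conv F G x : tower_at F x -> tower_at G x ->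
  tower_at (fun n t => conv (fun i => F i t) (fun i => G i t) n) x.
Proof.
  intros HF HG n.
  pose proof (conv_derive G x HG n 0 F) as H.
  match goal with |- is_Cderive _ _ ?r => set (R0 := r) end.
  match type of H with _ -> is_Cderive _ _ ?r => replace r with R0 in H end.
  - apply H. intros i. rewrite Nat.add_0_r. apply HF.
  - unfold R0. simpl (INR 0). ring.
Qed.

Lemma jet_ext f g : locally 0 (fun x => f x = g x) -> smooth f ->
  smooth g /\ locally 0 (fun x => forall n, jet g n x = jet f n x).
Proof.
  intros H Hf. apply jet_of_tower; auto.
  revert H; apply filter_imp; intros x <-. now rewrite jet_0.
Qed.

Lemma jet_plus f g : smooth f -> smooth g ->
  smooth (fun x => f x + g x)%C /\
  locally 0 (fun x => forall n, jet (fun x => f x + g x)%C n x = (jet f n x + jet g n x)%C).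
Proof.
  intros Hf Hg. apply jet_of_tower with (F := fun n x => (jet f n x + jet g n x)%C).
  - generalize (filter_and _ _ Hf Hg); apply filter_imp; intros x [H1 H2] n.
    rewrite Cmult_plus_distr_l. apply is_Cderive_plus; auto.
  - apply filter_forall; intros x. now rewrite !jet_0.
Qed.

Lemma jet_mult f g : smooth f -> smooth g ->
  smooth (fun x => f x * g x)%C /\
  locally 0 (fun x => forall n, jet (fun x => f x * g x)%C n x =
     conv (fun i => jet f i x) (fun i => jet g i x) n).
Proof.
  intros Hf Hg.
  apply jet_of_tower with (F := fun n x => conv (fun i => jet f i x) (fun i => jet g i x) n).
  - generalize (filter_and _ _ Hf Hg); apply filter_imp; intros x [H1 H2].
    apply (tower_conv (jet f) (jet g)); auto.
  - apply filter_forall; intros x. simpl. now rewrite !jet_0.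
Qed.

Definition const_jet (c : C) (n : nat) : C := match n with O => c | _ => 0%C end.

Lemma jet_const c : smooth (fun _ => c) /\
  locally 0 (fun x => forall n, jet (fun _ => c) n x = const_jet c n).
Proof.
  apply jet_of_tower with (F := fun n x => const_jet c n).
  - apply filter_forall; intros x n. simpl (const_jet c (S n)).
    rewrite Cmult_0_r. apply is_Cderive_const.
  - apply filter_forall; auto.
Qed.

Definition id_jet (x : R) (n : nat) : C :=
  match n with O => RtoC x | 1%nat => 1%C | _ => 0%C end.

Lemma jet_id : smooth RtoC /\
  locally 0 (fun x => forall n, jet RtoC n x = id_jet x n).
Proof.
  apply jet_of_tower with (F := fun n x => id_jet x n).
  - apply filter_forall; intros x n. destruct n as [|n].
    + simpl. rewrite Cmult_1_l. apply is_Cderive_id.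
    + simpl (id_jet x (S (S n))). rewrite Cmult_0_r.
      destruct n; simpl; apply is_Cderive_const.
  - apply filter_forall; auto.
Qed.

(** * Hadamard's lemma *)

Lemma locally_Rabs r x : Rabs x < r -> locally x (fun y => Rabs y < r).
Proof.
  intros H. assert (Hp : 0 < r - Rabs x) by lra.
  exists (mkposreal _ Hp). intros y Hy.
  unfold ball in Hy; simpl in Hy; unfold AbsRing_ball, abs, minus, plus, opp in Hy; simpl in Hy.
  pose proof (Rabs_triang_inv y x). unfold Rminus in *. lra.
Qed.

Lemma Rabs_mult_unit t x r : 0 <= t <= 1 -> Rabs x < r -> Rabs (t * x) < r.
Proof.
  intros Ht Hx. rewrite Rabs_mult, (Rabs_pos_eq t); [|lra].
  pose proof (Rabs_pos x). nra.
Qed.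

(** The n-th normalized derivative of x |-> int_0^1 f'(t x) dt, where F is the
    tower of f. *)
Definition hadamard (F : nat -> R -> R) (n : nat) (x : R) : R :=
  RInt (fun t => INR (S n) * t ^ n * F (S n) (t * x)) 0 1.

Section Hadamard.

Variables (F : nat -> R -> R) (r : R).
Hypothesis HF : forall n x, Rabs x < r -> is_derive (F n) x (INR (S n) * F (S n) x).

Let f n x t := INR (S n) * t ^ n * F (S n) (t * x).

Lemma hadamard_continuous n x t : Rabs x < r -> 0 <= t <= 1 -> continuous (f n x) t.
Proof.
  intros Hx Ht. apply (ex_derive_continuous (K := R_AbsRing) (V := R_NormedModule)).
  unfold f. auto_derive. repeat split.
  eexists; apply HF. now apply Rabs_mult_unit.
Qed.

Lemma hadamard_ex_RInt n x : Rabs x < r -> ex_RInt (f n x) 0 1.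
Proof.
  intros Hx. apply (ex_RInt_continuous (V := R_CompleteNormedModule)).
  rewrite Rmin_left, Rmax_right by lra. intros t Ht. now apply hadamard_continuous.
Qed.

Lemma hadamard_is_derive_param n x t : Rabs (t * x) < r ->
  is_derive (fun u => f n u t) x (INR (S n) * f (S n) x t).
Proof.
  intros Hx. unfold f.
  evar_last.
  { apply (is_derive_scal (fun u => F (S n) (t * u)) x (INR (S n) * t ^ n)).
    apply (is_derive_comp (F (S n)) (fun u => t * u)).
    - now apply HF.
    - apply (is_derive_scal (fun u => u) x t 1). apply (is_derive_id x). }
  unfold scal; simpl; unfold mult; simpl. ring.
Qed.

Lemma hadamard_derive n x : Rabs x < r ->
  is_derive (hadamard F n) x (INR (S n) * hadamard F (S n) x).
Proof.
  intros Hx. unfold hadamard at 2.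
  rewrite <- (RInt_scal (V := R_CompleteNormedModule)) by now apply hadamard_ex_RInt.
  rewrite (RInt_ext _ (fun t => Derive (fun u => f n u t) x)).
  - apply (is_derive_RInt_param (f n)).
    + generalize (locally_Rabs r x Hx); apply filter_imp; intros y Hy t Ht.
      rewrite Rmin_left, Rmax_right in Ht by lra.
      eexists. apply hadamard_is_derive_param. now apply Rabs_mult_unit.
    + rewrite Rmin_left, Rmax_right by lra. intros t Ht.
      assert (Hc : continuity_2d_pt (fun u v => v * u) x t)
        by (apply continuity_2d_pt_mult; [apply continuity_2d_pt_id2 | apply continuity_2d_pt_id1]).
      apply (continuity_2d_pt_ext_loc (fun u v => INR (S n) * (INR (S (S n)) * v ^ S n * F (S (S n)) (v * u)))).
      * assert (Hp : 0 < r - Rabs (t * x)) by (pose proof (Rabs_mult_unit t x r Ht Hx); lra).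
        destruct (Hc (mkposreal _ Hp)) as [d Hd]. exists d. intros u v Hu Hv.
        symmetry. apply is_derive_unique. apply hadamard_is_derive_param.
        specialize (Hd u v Hu Hv). simpl in Hd.
        pose proof (Rabs_triang_inv (v * u) (t * x)). lra.
      * apply continuity_2d_pt_mult; [apply continuity_2d_pt_const|].
        apply continuity_2d_pt_mult.
        -- apply continuity_2d_pt_mult; [apply continuity_2d_pt_const|].
           apply (continuity_1d_2d_pt_comp (fun v => v ^ S n) (fun u v => v)).
           ++ apply continuity_pt_filterlim. apply (ex_derive_continuous (fun v => v ^ S n)).
              auto_derive; auto.
           ++ apply continuity_2d_pt_id2.
        -- apply (continuity_1d_2d_pt_comp (F (S (S n))) (fun u v => v * u)); auto.
           apply continuity_pt_filterlim. apply (ex_derive_continuous (F (S (S n)))).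
           eexists. apply HF. now apply Rabs_mult_unit.
    + generalize (locally_Rabs r x Hx); apply filter_imp; intros y Hy. now apply hadamard_ex_RInt.
  - rewrite Rmin_left, Rmax_right by lra. intros t Ht. symmetry.
    apply is_derive_unique. apply hadamard_is_derive_param. apply Rabs_mult_unit; auto; lra.
Qed.

Lemma hadamard_factor x : Rabs x < r -> F O x = F O 0 + x * hadamard F O x.
Proof.
  intros Hx.
  assert (H : is_RInt (fun t => x * f O x t) 0 1 (minus (F O (1 * x)) (F O (0 * x)))).
  { apply (is_RInt_derive (fun t => F O (t * x))).
    - rewrite Rmin_left, Rmax_right by lra. intros t Ht. evar_last.
      { apply (is_derive_comp (F O) (fun u => u * x)).
        - apply HF. now apply Rabs_mult_unit.
        - auto_derive; auto. }
      unfold scal; simpl; unfold mult, f; simpl. ring.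
    - rewrite Rmin_left, Rmax_right by lra. intros t Ht.
      apply (continuous_scal_r x (f O x)). now apply hadamard_continuous. }
  apply (is_RInt_unique (V := R_CompleteNormedModule)) in H.
  rewrite (RInt_scal (V := R_CompleteNormedModule)) in H by now apply hadamard_ex_RInt.
  unfold minus, plus, opp, scal in H; simpl in H; unfold mult in H; simpl in H.
  rewrite Rmult_1_l, Rmult_0_l in H. unfold hadamard. unfold f in H.
  simpl in H |- *. lra.
Qed.

Lemma hadamard_bound n b x : Rabs x < r ->
  (forall y, Rabs y < r -> Rabs (INR (S n) * F (S n) y) <= b) -> Rabs (hadamard F n x) <= b.
Proof.
  intros Hx Hb. replace b with ((1 - 0) * b) by ring.
  apply (abs_RInt_le_const (f n x)); [lra | now apply hadamard_ex_RInt |].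
  intros t Ht. unfold f.
  replace (INR (S n) * t ^ n * F (S n) (t * x)) with (t ^ n * (INR (S n) * F (S n) (t * x))) by ring.
  rewrite Rabs_mult, (Rabs_pos_eq (t ^ n)) by (apply pow_le; lra).
  specialize (Hb (t * x) (Rabs_mult_unit t x r Ht Hx)).
  assert (t ^ n <= 1) by (rewrite <- (pow1 n); apply pow_incr; lra).
  assert (0 <= t ^ n) by (apply pow_le; lra).
  pose proof (Rabs_pos (INR (S n) * F (S n) (t * x))). nra.
Qed.

End Hadamard.

Lemma Cmod_le_Re_Im z b : Rabs (Re z) <= b -> Rabs (Im z) <= b -> Cmod z <= 2 * b.
Proof.
  intros H1 H2. eapply Rle_trans; [apply Cmod_2Rmax|].
  assert (Hs : sqrt 2 <= 2).
  { rewrite <- (sqrt_square 2) at 2 by lra. apply sqrt_le_1; lra. }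
  assert (Hm : Rmax (Rabs (fst z)) (Rabs (snd z)) <= b) by now apply Rmax_lub.
  assert (0 <= Rmax (Rabs (fst z)) (Rabs (snd z))).
  { eapply Rle_trans; [apply Rabs_pos | apply Rmax_l]. }
  pose proof (sqrt_pos 2). nra.
Qed.

Lemma Re_scal a z : Re (RtoC a * z) = a * Re z.
Proof. unfold Cmult, RtoC, Re, Im; simpl. ring. Qed.

Lemma Im_scal a z : Im (RtoC a * z) = a * Im z.
Proof. unfold Cmult, RtoC, Re, Im; simpl. ring. Qed.

Lemma im_le_Cmod z : Rabs (Im z) <= Cmod z.
Proof. eapply Rle_trans; [|apply Rmax_Cmod]. apply Rmax_r. Qed.

Lemma locally_radius (P : R -> Prop) : locally 0 P -> exists r, 0 < r /\ forall x, Rabs x < r -> P x.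
Proof.
  intros [r H]. exists r. split; [apply cond_pos|]. intros x Hx. apply H.
  unfold ball; simpl; unfold AbsRing_ball, abs, minus, plus, opp; simpl.
  now rewrite Ropp_0, Rplus_0_r.
Qed.

Lemma radius_locally (P : R -> Prop) r : 0 < r -> (forall x, Rabs x < r -> P x) -> locally 0 P.
Proof.
  intros Hr H. eapply filter_imp; [exact H|]. apply locally_Rabs. now rewrite Rabs_R0.
Qed.

(** The bound says that the n-th derivative of the quotient is controlled by the
    (n+1)-st derivative of f on any given neighborhood; the factor 2 comes from
    treating the real and imaginary parts separately. *)
Lemma smooth_hadamard f : smooth f ->
  exists g, smooth g /\ locally 0 (fun x => f x = f 0 + RtoC x * g x)%C /\
  forall U : R -> Prop, locally 0 U -> locally 0 (fun x => forall n b,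
    (forall y, U y -> Cmod (RtoC (INR (S n)) * jet f (S n) y) <= b) -> Cmod (jet g n x) <= 2 * b).
Proof.
  intros Hf. destruct (locally_radius _ Hf) as (r & Hr & HT).
  set (FR := fun n x => Re (jet f n x)). set (FI := fun n x => Im (jet f n x)).
  assert (HR : forall n x, Rabs x < r -> is_derive (FR n) x (INR (S n) * FR (S n) x)).
  { intros n x Hx. destruct (HT x Hx n) as [H _]. now rewrite Re_scal in H. }
  assert (HI : forall n x, Rabs x < r -> is_derive (FI n) x (INR (S n) * FI (S n) x)).
  { intros n x Hx. destruct (HT x Hx n) as [_ H]. now rewrite Im_scal in H. }
  set (G := fun n x => (hadamard FR n x, hadamard FI n x) : C).
  destruct (jet_of_tower G (G O)) as [Hg Hj].
  { apply (radius_locally _ r Hr). intros x Hx n. split; cbn [Re Im G fst snd].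
    - rewrite Re_scal. now apply (hadamard_derive FR r).
    - rewrite Im_scal. now apply (hadamard_derive FI r). }
  { now apply filter_forall. }
  exists (G O). split; [exact Hg|]. split.
  - apply (radius_locally _ r Hr). intros x Hx.
    pose proof (hadamard_factor FR r HR x Hx) as e1.
    pose proof (hadamard_factor FI r HI x Hx) as e2.
    unfold FR in e1 at 1 2; unfold FI in e2 at 1 2. rewrite !jet_0 in e1, e2.
    apply injective_projections.
    + change (Re (f x) = Re (f 0) + Re (RtoC x * G O x)). now rewrite Re_scal.
    + change (Im (f x) = Im (f 0) + Im (RtoC x * G O x)). now rewrite Im_scal.
  - intros U HU. destruct (locally_radius _ HU) as (r' & Hr' & HU').
    assert (Hm : 0 < Rmin r r') by now apply Rmin_pos.
    generalize (filter_and _ _ Hj (radius_locally _ _ Hm (fun x H => H))).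
    apply filter_imp; intros x [Hx1 Hx2] n b Hb. rewrite Hx1.
    pose proof (Rmin_l r r'). pose proof (Rmin_r r r').
    apply Cmod_le_Re_Im; cbn [G Re Im fst snd].
    + apply (hadamard_bound FR (Rmin r r')); auto.
      * intros m y Hy. apply HR. lra.
      * intros y Hy. eapply Rle_trans; [|apply (Hb y), HU'; lra].
        unfold FR. rewrite <- Re_scal. apply re_le_Cmod.
    + apply (hadamard_bound FI (Rmin r r')); auto.
      * intros m y Hy. apply HI. lra.
      * intros y Hy. eapply Rle_trans; [|apply (Hb y), HU'; lra].
        unfold FI. rewrite <- Im_scal. apply im_le_Cmod.
Qed.

Lemma jet_derive f : smooth f -> smooth (CDerive_n f 1) /\
  locally 0 (fun x => forall n, jet (CDerive_n f 1) n x = (RtoC (INR (S n)) * jet f (S n) x)%C).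
Proof.
  intros Hf. apply jet_of_tower with (F := fun n x => (RtoC (INR (S n)) * jet f (S n) x)%C).
  - revert Hf; unfold smooth; apply filter_imp; intros x Hx n. apply is_Cderive_scal. apply Hx.
  - apply filter_forall; intros x. apply CDerive_n_jet.
Qed.

Lemma class_E1_jet M f : class_E1 M f <-> smooth f /\
  exists A sigma, 0 < A /\ 0 < sigma /\
    locally 0 (fun x => forall n, Cmod (jet f n x) <= A * sigma ^ n * M n).
Proof.
  unfold class_E1. rewrite smooth_germ_iff.
  assert (K : forall A sigma n x, Cmod (CDerive_n f n x) <= A * sigma ^ n * INR (fact n) * M n <->
    Cmod (jet f n x) <= A * sigma ^ n * M n).
  { intros A sigma n x. rewrite CDerive_n_jet, Cmod_mult, Cmod_R, (Rabs_pos_eq _ (pos_INR _)).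
    pose proof (INR_fact_lt_0 n).
    replace (A * sigma ^ n * INR (fact n) * M n) with (INR (fact n) * (A * sigma ^ n * M n)) by ring.
    split; intros H0.
    - now apply Rmult_le_reg_l in H0.
    - apply Rmult_le_compat_l; lra. }
  split; intros [Hs H]; split; auto; clear Hs.
  - destruct H as (U & A & sigma & HU & HA & Hsig & H).
    exists A, sigma; repeat split; auto.
    revert HU; apply filter_imp; intros x Hx n. now apply K, H.
  - destruct H as (A & sigma & HA & Hsig & H).
    exists (fun x => forall n, Cmod (jet f n x) <= A * sigma ^ n * M n), A, sigma.
    repeat split; auto. intros j x Hx. now apply K.
Qed.

(** The derivatives of the quotient are bounded by those of f', and f' belongs to
    the class by stability. *)
Lemma class_E1_hadamard M f : stable_under_derivation M -> class_E1 M f ->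
  exists g, class_E1 M g /\ locally 0 (fun x => f x = f 0 + RtoC x * g x)%C.
Proof.
  intros HM Hf. pose proof (HM f Hf) as Hd.
  apply class_E1_jet in Hf, Hd. destruct Hf as [Hf _]. destruct Hd as (_ & A & sigma & HA & Hsig & Hd).
  destruct (smooth_hadamard f Hf) as (g & Hg & Hfg & Hb).
  exists g. split; [|exact Hfg]. apply class_E1_jet. split; [exact Hg|].
  exists (2 * A), sigma; repeat split; [lra|exact Hsig|].
  destruct (jet_derive f Hf) as [_ Hj].
  generalize (Hb _ (filter_and _ _ Hj Hd)); apply filter_imp; intros x Hx n.
  rewrite !Rmult_assoc. apply Hx. intros y [H1 H2]. rewrite <- H1, <- Rmult_assoc. apply H2.
Qed.

(** * Flat germs and orders of vanishing *)

Lemma smooth_mult f g : smooth f -> smooth g -> smooth (fun x => f x * g x)%C.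
Proof. intros; now apply jet_mult. Qed.

Lemma smooth_plus f g : smooth f -> smooth g -> smooth (fun x => f x + g x)%C.
Proof. intros; now apply jet_plus. Qed.

Lemma smooth_const c : smooth (fun _ => c).
Proof. apply jet_const. Qed.

Lemma smooth_pow f k : smooth f -> smooth (fun x => Cpow (f x) k).
Proof.
  intros Hf. induction k; simpl; [apply smooth_const | now apply smooth_mult].
Qed.

Lemma flat_germ_jet f : flat_germ f <-> forall n, jet f n 0 = 0%C.
Proof.
  unfold flat_germ. split; intros H n; specialize (H n); rewrite CDerive_n_jet in *.
  - destruct (Ceq_dec (jet f n 0) 0%C) as [E|E]; auto. exfalso.
    revert H. apply Cmult_neq_0; auto. intros K. apply RtoC_inj in K. now apply (INR_fact_neq_0 n).
  - now rewrite H, Cmult_0_r.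
Qed.

Lemma conv_const_l c b n : conv (const_jet c) b n = (c * b n)%C.
Proof.
  assert (H0 : forall n, conv (fun _ => 0%C) b n = 0%C).
  { induction n0; simpl; [ring|]. rewrite IHn0. ring. }
  destruct n; simpl; [reflexivity|].
  rewrite H0. ring.
Qed.

Lemma conv_0_r (b : nat -> C) n : forall a, (forall i, b i = 0%C) -> conv a b n = 0%C.
Proof.
  induction n; intros a H; simpl; rewrite H; [ring|]. rewrite IHn; auto. ring.
Qed.

Lemma flat_mult f g : smooth f -> smooth g -> flat_germ g -> flat_germ (fun x => f x * g x)%C.
Proof.
  intros Hf Hg. rewrite !flat_germ_jet. intros H n.
  destruct (jet_mult f g Hf Hg) as [_ Hj]. apply locally_singleton in Hj.
  rewrite Hj. exact (conv_0_r _ n _ H).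
Qed.

Lemma flat_plus f g : smooth f -> smooth g -> flat_germ f -> flat_germ g ->
  flat_germ (fun x => f x + g x)%C.
Proof.
  intros Hf Hg. rewrite !flat_germ_jet. intros H1 H2 n.
  destruct (jet_plus f g Hf Hg) as [_ Hj]. apply locally_singleton in Hj.
  rewrite Hj, H1, H2. ring.
Qed.

Lemma flat_ext f g : locally 0 (fun x => f x = g x) -> smooth f -> flat_germ f -> flat_germ g.
Proof.
  intros H Hf. rewrite !flat_germ_jet. intros H1 n.
  destruct (jet_ext _ _ H Hf) as [_ Hj]. apply locally_singleton in Hj.
  now rewrite Hj.
Qed.

Lemma flat_zero (f : R -> C) : locally 0 (fun x => f x = 0%C) -> flat_germ f.
Proof.
  intros H. apply (flat_ext (fun _ => 0%C)).
  - revert H; apply filter_imp; auto.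
  - apply smooth_const.
  - apply flat_germ_jet. intros n.
    destruct (jet_const 0%C) as [_ Hj]. apply locally_singleton in Hj. rewrite Hj.
    now destruct n.
Qed.

Lemma smooth_divide k : forall f, smooth f -> (forall j, (j < k)%nat -> jet f j 0 = 0%C) ->
  exists u, smooth u /\ locally 0 (fun x => f x = Cpow (RtoC x) k * u x)%C /\ u 0 = jet f k 0.
Proof.
  induction k; intros f Hf H.
  - exists f. repeat split; auto.
    + apply filter_forall; intros x. simpl. now rewrite Cmult_1_l.
    + now rewrite jet_0.
  - destruct (smooth_hadamard f Hf) as (g & Hg & Hfg & _).
    assert (H0 : f 0 = 0%C) by (rewrite <- jet_0; apply H; lia).
    assert (Hj : forall n, jet f (S n) 0 = jet g n 0).
    { intros n.
      destruct (jet_mult RtoC g (proj1 jet_id) Hg) as [Hs Hm].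
      assert (Hfg' : locally 0 (fun x => RtoC x * g x = f x)%C).
      { revert Hfg; apply filter_imp; intros x ->. rewrite H0. ring. }
      destruct (jet_ext _ _ Hfg' Hs) as [_ Hj].
      apply locally_singleton in Hj, Hm. rewrite Hj, Hm. cbn [conv].
      pose proof (locally_singleton _ _ (proj2 jet_id)) as Hi. cbn beta in Hi.
      rewrite Hi. simpl (id_jet 0 0).
      rewrite (conv_ext_l _ (const_jet 1)); [rewrite conv_const_l; ring|].
      intros i. rewrite Hi. now destruct i. }
    destruct (IHk g Hg) as (u & Hu & Hgu & Hu0).
    { intros j Hj'. rewrite <- Hj. apply H. lia. }
    exists u. split; [exact Hu|]. split.
    + generalize (filter_and _ _ Hfg Hgu); apply filter_imp; intros x [e1 e2].
      rewrite e1, e2, H0. simpl. ring.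
    + now rewrite Hj.
Qed.

Lemma nonflat_order f : smooth f -> ~ flat_germ f ->
  exists k u, smooth u /\ u 0 <> 0%C /\ locally 0 (fun x => f x = Cpow (RtoC x) k * u x)%C.
Proof.
  intros Hf Hn. rewrite flat_germ_jet in Hn. apply not_all_ex_not in Hn.
  destruct Hn as [n Hn].
  assert (Hk : exists k, jet f k 0 <> 0%C /\ forall j, (j < k)%nat -> jet f j 0 = 0%C).
  { revert Hn. induction (Wf_nat.lt_wf n) as [n _ IH]. intros Hn.
    destruct (classic (exists j, (j < n)%nat /\ jet f j 0 <> 0%C)) as [(j & Hj & Hj')|Hno].
    - now apply (IH j).
    - exists n. split; auto. intros j Hj.
      destruct (Ceq_dec (jet f j 0) 0%C); auto. exfalso; apply Hno. eauto. }
  destruct Hk as (k & Hk & Hlt).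
  destruct (smooth_divide k f Hf Hlt) as (u & Hu & Hfu & Hu0).
  exists k, u. repeat split; auto. congruence.
Qed.

Lemma smooth_continuous f e : smooth f -> 0 < e -> locally 0 (fun x => Cmod (f x - f 0)%C < e).
Proof.
  intros Hf He. pose proof (locally_singleton _ _ Hf O) as [H1 H2].
  apply (is_derive_ext _ (fun t => Re (f t))) in H1; [|intros t; now rewrite jet_0].
  apply (is_derive_ext _ (fun t => Im (f t))) in H2; [|intros t; now rewrite jet_0].
  assert (C1 : continuous (fun t => Re (f t)) 0)
    by (apply (ex_derive_continuous (K := R_AbsRing) (V := R_NormedModule) (fun t => Re (f t))); eexists; exact H1).
  assert (C2 : continuous (fun t => Im (f t)) 0)
    by (apply (ex_derive_continuous (K := R_AbsRing) (V := R_NormedModule) (fun t => Im (f t))); eexists; exact H2).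
  assert (He' : 0 < e / 4) by lra.
  assert (K : forall p : R -> R, continuous p 0 -> locally 0 (fun x => Rabs (p x - p 0) < e / 4)).
  { intros p Hp. apply (Hp (fun y => Rabs (y - p 0) < e / 4)).
    exists (mkposreal _ He'). intros y Hy. exact Hy. }
  generalize (filter_and _ _ (K _ C1) (K _ C2)). apply filter_imp; intros x [A B].
  apply Rle_lt_trans with (2 * (e / 4)); [|lra].
  apply Cmod_le_Re_Im; apply Rlt_le; assumption.
Qed.

Lemma smooth_nonzero f : smooth f -> f 0 <> 0%C -> locally 0 (fun x => f x <> 0%C).
Proof.
  intros Hf H0. apply Cmod_gt_0 in H0. generalize (smooth_continuous f _ Hf H0).
  apply filter_imp; intros x Hx E. rewrite E in Hx.
  replace (0 - f 0)%C with (- f 0)%C in Hx by ring. rewrite Cmod_opp in Hx. lra.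
Qed.

Lemma punctured_of_local (P : R -> Prop) : locally 0 P -> locally' 0 P.
Proof. unfold locally', within; apply filter_imp; auto. Qed.

Lemma punctured_nonempty (P : R -> Prop) : locally' 0 P -> exists x, P x.
Proof.
  intros H. destruct (locally_radius _ H) as (r & Hr & HP).
  exists (r / 2). apply HP; [rewrite Rabs_pos_eq; lra|].
  intros E. lra.
Qed.

Lemma punctured_neq0 : locally' 0 (fun x => RtoC x <> 0%C).
Proof.
  unfold locally', within. apply filter_forall; intros x Hx E. apply Hx. now apply RtoC_inj.
Qed.

Lemma nonflat_nonzero f : smooth f -> ~ flat_germ f -> locally' 0 (fun x => f x <> 0%C).
Proof.
  intros Hf Hn. destruct (nonflat_order f Hf Hn) as (k & u & Hu & Hu0 & Hfu).
  generalize (filter_and _ _ punctured_neq0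
    (punctured_of_local _ (filter_and _ _ Hfu (smooth_nonzero u Hu Hu0)))).
  apply filter_imp; intros x (Hx & -> & Hux).
  apply Cmult_neq_0; auto. now apply Cpow_nz.
Qed.

(** Identities are obtained after division by powers of x, hence off the origin;
    continuity brings them back to it. *)
Lemma smooth_eq_punctured f g : smooth f -> smooth g ->
  locally' 0 (fun x => f x = g x) -> locally 0 (fun x => f x = g x).
Proof.
  intros Hf Hg H.
  assert (Hd : smooth (fun x => f x + (- (1)) * g x)%C)
    by (apply smooth_plus; auto; apply smooth_mult; auto; apply smooth_const).
  assert (H0 : f 0 = g 0).
  { destruct (Ceq_dec (f 0) (g 0)) as [E|E]; auto. exfalso.
    assert (Hn : (f 0 + (- (1)) * g 0)%C <> 0%C).
    { intros K. apply E. replace (f 0) with (f 0 + (- (1)) * g 0 + g 0)%C by ring.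
      rewrite K. ring. }
    pose proof (smooth_nonzero _ Hd Hn) as K. apply punctured_of_local in K.
    destruct (punctured_nonempty _ (filter_and _ _ H K)) as [x [e1 e2]].
    apply e2. rewrite e1. ring. }
  unfold locally', within in H. revert H; apply filter_imp; intros x Hx.
  destruct (Req_dec x 0) as [->|]; auto.
Qed.

(** * Submultiplicative norms on truncated jets *)

Lemma sum_f_R0_shift u N : sum_f_R0 u (S N) = u O + sum_f_R0 (fun i => u (S i)) N.
Proof. rewrite decomp_sum; [reflexivity | lia]. Qed.

Lemma sum_f_R0_mono u N : (forall n, 0 <= u n) -> sum_f_R0 u N <= sum_f_R0 u (S N).
Proof. intros H. simpl. specialize (H (S N)). lra. Qed.

(** The shift s in the weight is forced by the induction along [conv], which
    replaces a by its shift. *)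
Lemma conv_weighted w : (forall n, 0 <= w n) -> (forall m n, w (m + n)%nat <= w m * w n) ->
  forall N s a b,
  sum_f_R0 (fun n => Cmod (conv a b n) * w (n + s)%nat) N <=
  sum_f_R0 (fun n => Cmod (a n) * w (n + s)%nat) N * sum_f_R0 (fun n => Cmod (b n) * w n) N.
Proof.
  intros Hw Hsub; induction N; intros s a b.
  - simpl. rewrite Cmod_mult. specialize (Hsub s O). rewrite Nat.add_0_r in Hsub.
    pose proof (Cmod_ge_0 (a O)). pose proof (Cmod_ge_0 (b O)).
    assert (0 <= Cmod (a O) * Cmod (b O)) by nra. nra.
  - rewrite sum_f_R0_shift.
    rewrite (sum_f_R0_shift (fun n => Cmod (a n) * w (n + s)%nat)).
    set (B := sum_f_R0 (fun n => Cmod (b n) * w n)).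
    specialize (IHN (S s) (fun i => a (S i)) b). cbn beta in IHN. fold (B N) in IHN.
    set (A' := sum_f_R0 (fun n => Cmod (a (S n)) * w (n + S s)%nat) N) in IHN.
    replace (sum_f_R0 (fun i => Cmod (a (S i)) * w (S i + s)%nat) N) with A'
      by (apply sum_eq; intros i _; now replace (S i + s)%nat with (i + S s)%nat by lia).
    assert (HA' : 0 <= A').
    { apply cond_pos_sum; intros; apply Rmult_le_pos; [apply Cmod_ge_0 | apply Hw]. }
    assert (HB : B N <= B (S N)).
    { apply sum_f_R0_mono; intros; apply Rmult_le_pos; [apply Cmod_ge_0 | apply Hw]. }
    assert (H0 : Cmod (conv a b 0) * w (0 + s)%nat <= Cmod (a O) * w s * (Cmod (b O) * w O)).
    { simpl. rewrite Cmod_mult. specialize (Hsub s O). rewrite Nat.add_0_r in Hsub.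
      pose proof (Cmod_ge_0 (a O)). pose proof (Cmod_ge_0 (b O)).
      assert (0 <= Cmod (a O) * Cmod (b O)) by nra. nra. }
    assert (H1 : sum_f_R0 (fun i => Cmod (conv a b (S i)) * w (S i + s)%nat) N <=
      sum_f_R0 (fun i => Cmod (b (S i)) * w (S i) * (Cmod (a O) * w s) +
         Cmod (conv (fun i => a (S i)) b i) * w (i + S s)%nat) N).
    { apply sum_Rle; intros i _. cbn [conv].
      replace (i + S s)%nat with (S i + s)%nat by lia.
      pose proof (Cmod_triangle (a O * b (S i)) (conv (fun i => a (S i)) b i)) as T.
      rewrite Cmod_mult in T.
      pose proof (Hsub (S i) s). pose proof (Hw (S i + s)%nat).
      pose proof (Cmod_ge_0 (a O)). pose proof (Cmod_ge_0 (b (S i))).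
      assert (0 <= Cmod (a O) * Cmod (b (S i))) by nra. nra. }
    rewrite sum_plus, <- scal_sum in H1.
    assert (H2 : B (S N) = Cmod (b O) * w O + sum_f_R0 (fun i => Cmod (b (S i)) * w (S i)) N).
    { apply sum_f_R0_shift. }
    change (0 + s)%nat with s in *. nra.
Qed.

Section Class.

Variable M : nat -> R.
Hypothesis M_incr : increasing_seq M.
Hypothesis M_0 : M 0%nat = 1.
Hypothesis M_lc : log_convex M.

Lemma M_ge_1 n : 1 <= M n.
Proof. induction n; [rewrite M_0; lra|]. specialize (M_incr n). lra. Qed.

Lemma M_pos n : 0 < M n.
Proof. pose proof (M_ge_1 n); lra. Qed.

Lemma M_ratio m n : M (S n) / M n <= M (S (m + n)) / M (m + n)%nat.
Proof.
  induction m; [simpl; lra|].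
  eapply Rle_trans; [exact IHm|]. apply (M_lc (m + n)%nat).
Qed.

(** M (m + n) / M n is the product over j < m of the ratios M (n+j+1) / M (n+j), and
    each of them is at least M (j+1) / M j. *)
Lemma M_supermult m n : M m * M n <= M (m + n)%nat.
Proof.
  induction m; [rewrite M_0; simpl; lra|]. simpl.
  pose proof (M_ratio n m) as H. rewrite Nat.add_comm in H.
  pose proof (M_pos m). pose proof (M_pos (m + n)). pose proof (M_pos (S m)).
  replace (M (S m) * M n) with (M (S m) / M m * (M m * M n)) by (field; lra).
  replace (M (S (m + n))) with (M (S (m + n)) / M (m + n)%nat * M (m + n)%nat) by (field; lra).
  assert (0 < M (S m) / M m) by (apply Rdiv_lt_0_compat; auto).
  pose proof (M_pos n). nra.
Qed.

Definition wnorm (rho : R) (N : nat) (a : nat -> C) : R :=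
  sum_f_R0 (fun n => Cmod (a n) / M n * rho ^ n) N.

Lemma wnorm_weight rho N a : wnorm rho N a = sum_f_R0 (fun n => Cmod (a n) * (rho ^ n / M n)) N.
Proof. apply sum_eq; intros n _. field. apply Rgt_not_eq, M_pos. Qed.

Lemma wnorm_term_nonneg rho a n : 0 <= rho -> 0 <= Cmod (a n) / M n * rho ^ n.
Proof.
  intros H. apply Rmult_le_pos; [|apply pow_le; auto].
  apply Rle_mult_inv_pos; [apply Cmod_ge_0 | apply M_pos].
Qed.

Lemma wnorm_nonneg rho N a : 0 <= rho -> 0 <= wnorm rho N a.
Proof. intros H. apply cond_pos_sum; intros n; now apply wnorm_term_nonneg. Qed.

Lemma wnorm_conv rho N a b : 0 <= rho -> wnorm rho N (conv a b) <= wnorm rho N a * wnorm rho N b.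
Proof.
  intros H. rewrite !wnorm_weight.
  pose proof (conv_weighted (fun n => rho ^ n / M n)) as K.
  assert (Hs : forall s, sum_f_R0 (fun n => Cmod (conv a b n) * (rho ^ n / M n)) s =
     sum_f_R0 (fun n => Cmod (conv a b n) * (rho ^ (n + 0) / M (n + 0)%nat)) s).
  { intros s; apply sum_eq; intros; now rewrite Nat.add_0_r. }
  rewrite Hs.
  replace (sum_f_R0 (fun n => Cmod (a n) * (rho ^ n / M n)) N) with
     (sum_f_R0 (fun n => Cmod (a n) * (rho ^ (n + 0) / M (n + 0)%nat)) N)
    by (apply sum_eq; intros; now rewrite Nat.add_0_r).
  apply K.
  - intros n. apply Rle_mult_inv_pos; [now apply pow_le | apply M_pos].
  - intros m n. rewrite pow_add.
    pose proof (M_supermult m n). pose proof (M_pos m). pose proof (M_pos n).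
    replace (rho ^ m / M m * (rho ^ n / M n)) with (rho ^ m * rho ^ n / (M m * M n))
      by (field; lra).
    apply Rmult_le_compat_l; [apply Rmult_le_pos; now apply pow_le|].
    apply Rinv_le_contravar; nra.
Qed.

Lemma wnorm_plus rho N a b : 0 <= rho -> wnorm rho N (fun n => a n + b n)%C <= wnorm rho N a + wnorm rho N b.
Proof.
  intros H. unfold wnorm. rewrite <- sum_plus. apply sum_Rle; intros n _.
  rewrite <- Rmult_plus_distr_r. apply Rmult_le_compat_r; [now apply pow_le|].
  unfold Rdiv. rewrite <- Rmult_plus_distr_r. apply Rmult_le_compat_r.
  - apply Rlt_le, Rinv_0_lt_compat, M_pos.
  - apply Cmod_triangle.
Qed.

Lemma wnorm_ext rho N a b : (forall n, a n = b n) -> wnorm rho N a = wnorm rho N b.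
Proof. intros H. apply sum_eq; intros n _; now rewrite H. Qed.

Lemma wnorm_mono rho rho' N a : 0 <= rho <= rho' -> wnorm rho N a <= wnorm rho' N a.
Proof.
  intros H. apply sum_Rle; intros n _. apply Rmult_le_compat_l.
  - apply Rle_mult_inv_pos; [apply Cmod_ge_0 | apply M_pos].
  - now apply pow_incr.
Qed.

Lemma wnorm_const rho N c : 0 <= rho -> wnorm rho N (const_jet c) = Cmod c.
Proof.
  intros H. unfold wnorm. induction N.
  - simpl. rewrite M_0. field.
  - rewrite tech5, IHN. simpl (const_jet c (S N)). rewrite Cmod_0. lra.
Qed.

Lemma wnorm_id rho N x : 0 <= rho -> wnorm rho N (id_jet x) <= Rabs x + rho.
Proof.
  intros H. destruct N as [|N].
  - unfold wnorm; simpl. rewrite M_0, Cmod_R. lra.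
  - apply Rle_trans with (wnorm rho 1 (id_jet x)).
    + right. induction N; [reflexivity|]. rewrite <- IHN. unfold wnorm.
      rewrite tech5. simpl (id_jet x (S (S N))). rewrite Cmod_0. lra.
    + unfold wnorm. simpl. rewrite M_0, Cmod_R, Cmod_1.
      pose proof (M_ge_1 1). assert (/ M 1%nat <= 1).
      { rewrite <- Rinv_1. apply Rinv_le_contravar; lra. }
      nra.
Qed.

Definition wnorm_bounded (f : R -> C) (rho B : R) : Prop :=
  locally 0 (fun x => forall N, wnorm rho N (fun n => jet f n x) <= B).

Definition E1 (f : R -> C) : Prop :=
  smooth f /\ exists rho B, 0 < rho /\ wnorm_bounded f rho B.

Lemma sum_half N : sum_f_R0 (fun n => (/ 2) ^ n) N <= 2.
Proof.
  assert (sum_f_R0 (fun n => (/ 2) ^ n) N = 2 - (/ 2) ^ N).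
  { induction N; simpl; [lra|]. simpl in IHN. rewrite IHN. lra. }
  assert (0 <= (/ 2) ^ N) by (apply pow_le; lra). lra.
Qed.

(** From pointwise bounds A sigma^n M_n to norms: rho = 1 / (2 sigma) leaves a
    geometric series of ratio 1/2. *)
Lemma class_E1_iff f : class_E1 M f <-> E1 f.
Proof.
  rewrite class_E1_jet. unfold E1.
  split; intros [Hs H]; split; auto; clear Hs.
  - destruct H as (A & sigma & HA & Hsig & H).
    exists (/ (2 * sigma)), (2 * A).
    split; [apply Rinv_0_lt_compat; lra|].
    revert H; unfold wnorm_bounded; apply filter_imp; intros x Hx N.
    apply Rle_trans with (sum_f_R0 (fun n => (/ 2) ^ n * A) N).
    + apply sum_Rle; intros n _.
      pose proof (M_pos n) as Mp.
      assert (H2 : Cmod (jet f n x) / M n <= A * sigma ^ n).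
      { apply Rle_div_l; auto. }
      replace ((/ 2) ^ n * A) with (A * sigma ^ n * (/ (2 * sigma)) ^ n).
      * apply Rmult_le_compat_r; auto. apply pow_le, Rlt_le, Rinv_0_lt_compat; lra.
      * rewrite Rmult_assoc, <- Rpow_mult_distr.
        replace (sigma * / (2 * sigma)) with (/ 2) by (field; lra). ring.
    + rewrite <- scal_sum, (Rmult_comm 2). apply Rmult_le_compat_l; [lra | apply sum_half].
  - destruct H as (rho & B & Hrho & H).
    pose proof (Rabs_pos B).
    exists (Rabs B + 1), (/ rho).
    split; [lra|]. split; [now apply Rinv_0_lt_compat|].
    revert H; unfold wnorm_bounded; apply filter_imp; intros x Hx j. specialize (Hx j).
    assert (Hj : Cmod (jet f j x) / M j * rho ^ j <= Rabs B + 1).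
    { apply Rle_trans with B; [|pose proof (Rle_abs B); lra].
      eapply Rle_trans; [|exact Hx].
      destruct j; [right; reflexivity|]. unfold wnorm. rewrite tech5.
      assert (Hj : 0 <= wnorm rho j (fun n => jet f n x)) by (apply wnorm_nonneg; lra).
      unfold wnorm in Hj. lra. }
    rewrite pow_inv.
    apply (proj1 (Rle_div_l _ _ (M j) (M_pos j))).
    now apply (proj1 (Rle_div_r _ _ (rho ^ j) (pow_lt _ j Hrho))).
Qed.

Lemma wnorm_bounded_mono f rho rho' B B' : 0 <= rho' <= rho -> B <= B' ->
  wnorm_bounded f rho B -> wnorm_bounded f rho' B'.
Proof.
  intros Hr HB; unfold wnorm_bounded; apply filter_imp; intros x H N.
  eapply Rle_trans; [apply wnorm_mono; eassumption|]. eapply Rle_trans; eauto.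
Qed.

Lemma E1_smooth f : E1 f -> smooth f.
Proof. now intros []. Qed.

Lemma E1_ext f g : locally 0 (fun x => f x = g x) -> E1 f -> E1 g.
Proof.
  intros H [Hf (rho & B & Hr & Hb)].
  destruct (jet_ext _ _ H Hf) as [Hg Hj].
  split; auto. exists rho, B; split; auto.
  generalize (filter_and _ _ Hj Hb); unfold wnorm_bounded; apply filter_imp; intros x [H1 H2] N.
  erewrite wnorm_ext; [apply H2|]. intros n; apply H1.
Qed.

Lemma E1_plus f g : E1 f -> E1 g -> E1 (fun x => f x + g x)%C.
Proof.
  intros [Hf (r1 & B1 & Hr1 & Hb1)] [Hg (r2 & B2 & Hr2 & Hb2)].
  destruct (jet_plus f g Hf Hg) as [Hs Hj]. split; auto.
  assert (Hr : 0 < Rmin r1 r2) by now apply Rmin_pos.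
  exists (Rmin r1 r2), (B1 + B2); split; auto.
  apply (wnorm_bounded_mono _ _ (Rmin r1 r2) _ B1) in Hb1;
    [|split; [lra|apply Rmin_l]|lra].
  apply (wnorm_bounded_mono _ _ (Rmin r1 r2) _ B2) in Hb2;
    [|split; [lra|apply Rmin_r]|lra].
  generalize (filter_and _ _ Hj (filter_and _ _ Hb1 Hb2)).
  unfold wnorm_bounded; apply filter_imp; intros x (H0 & H1 & H2) N.
  rewrite (wnorm_ext _ _ _ _ H0). eapply Rle_trans; [apply wnorm_plus; lra|].
  specialize (H1 N); specialize (H2 N); lra.
Qed.

Lemma E1_mult f g : E1 f -> E1 g -> E1 (fun x => f x * g x)%C.
Proof.
  intros [Hf (r1 & B1 & Hr1 & Hb1)] [Hg (r2 & B2 & Hr2 & Hb2)].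
  destruct (jet_mult f g Hf Hg) as [Hs Hj]. split; auto.
  assert (Hr : 0 < Rmin r1 r2) by now apply Rmin_pos.
  exists (Rmin r1 r2), (B1 * B2); split; auto.
  apply (wnorm_bounded_mono _ _ (Rmin r1 r2) _ B1) in Hb1;
    [|split; [lra|apply Rmin_l]|lra].
  apply (wnorm_bounded_mono _ _ (Rmin r1 r2) _ B2) in Hb2;
    [|split; [lra|apply Rmin_r]|lra].
  generalize (filter_and _ _ Hj (filter_and _ _ Hb1 Hb2)).
  unfold wnorm_bounded; apply filter_imp; intros x (H0 & H1 & H2) N.
  rewrite (wnorm_ext _ _ _ _ H0). eapply Rle_trans; [apply wnorm_conv; lra|].
  apply Rmult_le_compat; auto; apply wnorm_nonneg; lra.
Qed.

Lemma E1_const c : E1 (fun _ => c).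
Proof.
  destruct (jet_const c) as [Hs Hj]. split; auto.
  exists 1, (Cmod c); split; [lra|].
  revert Hj; unfold wnorm_bounded; apply filter_imp; intros x Hx N.
  rewrite (wnorm_ext _ _ _ _ Hx), wnorm_const; lra.
Qed.

Lemma E1_id : E1 RtoC.
Proof.
  destruct jet_id as [Hs Hj]. split; auto.
  exists 1, 2; split; [lra|].
  assert (Hl : locally 0 (fun x => Rabs x < 1)).
  { exists (mkposreal 1 Rlt_0_1). intros y Hy.
    unfold ball in Hy; simpl in Hy; unfold AbsRing_ball, abs, minus, plus, opp in Hy; simpl in Hy.
    now rewrite Ropp_0, Rplus_0_r in Hy. }
  generalize (filter_and _ _ Hj Hl); unfold wnorm_bounded; apply filter_imp; intros x [H1 H2] N.
  rewrite (wnorm_ext _ _ _ _ H1). eapply Rle_trans; [apply wnorm_id; lra|]. lra.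
Qed.

Lemma E1_pow f k : E1 f -> E1 (fun x => Cpow (f x) k).
Proof.
  intros Hf. induction k; simpl; [apply E1_const | now apply E1_mult].
Qed.

Lemma E1_pointwise f g : (forall x, f x = g x) -> E1 f -> E1 g.
Proof. intros H. apply E1_ext. now apply filter_forall. Qed.

(** * Polynomials over the class *)

(** [poly n F]: F is a polynomial of degree less than n in y with coefficients in the
    class, given as a function together with a Horner form.  Working with functions
    avoids all reindexing of coefficients. *)
Inductive poly : nat -> (R -> C -> C) -> Prop :=
| poly_0 (F : R -> C -> C) : (forall x y, F x y = 0%C) -> poly 0 F
| poly_S n (c : R -> C) (G F : R -> C -> C) : E1 c -> poly n G ->
    (forall x y, F x y = c x + y * G x y)%C -> poly (S n) F.

Lemma poly_ext n F G : poly n F -> (forall x y, F x y = G x y) -> poly n G.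
Proof.
  intros H E. destruct H as [F H|n c K F Hc HK H].
  - apply poly_0. intros x y. now rewrite <- E.
  - apply (poly_S n c K); auto. intros x y. now rewrite <- E.
Qed.

Lemma poly_0_inv F : poly 0 F -> forall x y, F x y = 0%C.
Proof. intros H. now inversion H. Qed.

Lemma poly_S_inv n F : poly (S n) F ->
  exists c G, E1 c /\ poly n G /\ forall x y, F x y = (c x + y * G x y)%C.
Proof. intros H. inversion H; subst. eauto. Qed.

Lemma poly_zero n : poly n (fun _ _ => 0%C).
Proof.
  induction n; [now apply poly_0|].
  apply (poly_S n (fun _ => 0%C) (fun _ _ => 0%C)); auto; [apply E1_const|].
  intros; ring.
Qed.

Lemma poly_plus n F G : poly n F -> poly n G -> poly n (fun x y => F x y + G x y)%C.
Proof.
  revert F G; induction n; intros F G HF HG.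
  - apply poly_0. intros x y.
    rewrite (poly_0_inv F HF), (poly_0_inv G HG). ring.
  - destruct (poly_S_inv n F HF) as (c & F1 & Hc & HF1 & EF).
    destruct (poly_S_inv n G HG) as (d & G1 & Hd & HG1 & EG).
    apply (poly_S n (fun x => c x + d x)%C (fun x y => F1 x y + G1 x y)%C).
    + now apply E1_plus.
    + now apply IHn.
    + intros x y. rewrite EF, EG. ring.
Qed.

Lemma poly_mulc n (c : R -> C) F : E1 c -> poly n F -> poly n (fun x y => c x * F x y)%C.
Proof.
  intros Hc HF. induction HF as [F H|n a G F Ha HG IH H].
  - apply poly_0. intros x y. rewrite H. ring.
  - apply (poly_S n (fun x => c x * a x)%C (fun x y => c x * G x y)%C); auto.
    + now apply E1_mult.
    + intros x y. rewrite H. ring.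
Qed.

Lemma poly_muly n F : poly n F -> poly (S n) (fun x y => y * F x y)%C.
Proof.
  intros HF. apply (poly_S n (fun _ => 0%C) F); auto; [apply E1_const|].
  intros; ring.
Qed.

Lemma poly_mulyn k n F : poly n F -> poly (k + n) (fun x y => Cpow y k * F x y)%C.
Proof.
  intros HF. induction k; simpl.
  - apply (poly_ext n F); auto. intros; ring.
  - apply (poly_ext (S (k + n)) (fun x y => y * (Cpow y k * F x y))%C).
    + now apply poly_muly.
    + intros; ring.
Qed.

Lemma poly_const c : E1 c -> poly 1 (fun x _ => c x).
Proof.
  intros Hc. apply (poly_S 0 c (fun _ _ => 0%C)); auto; [now apply poly_0|].
  intros; ring.
Qed.

Lemma poly_weaken n m F : (n <= m)%nat -> poly n F -> poly m F.
Proof.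
  intros H HF; revert m H. induction HF as [F H|n a G F Ha HG IH H]; intros m Hm.
  - apply (poly_ext m (fun _ _ => 0%C)); [apply poly_zero|]. intros; now rewrite H.
  - destruct m as [|m]; [lia|]. apply (poly_S m a G); auto. apply IH; lia.
Qed.

Lemma poly_monomial n c : E1 c -> poly (S n) (fun x y => c x * Cpow y n)%C.
Proof.
  intros Hc. replace (S n) with (n + 1)%nat by lia.
  apply (poly_ext _ (fun x y => Cpow y n * c x)%C); [|intros; ring].
  now apply (poly_mulyn n 1 (fun x _ => c x)), poly_const.
Qed.

Lemma poly_scale n (s : R -> C) F : E1 s -> poly n F -> poly n (fun x y => F x (s x * y)%C).
Proof.
  intros Hs HF. induction HF as [F H|n a G F Ha HG IH H].
  - apply poly_0. intros; apply H.
  - apply (poly_S n a (fun x y => s x * G x (s x * y))%C); auto.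
    + now apply poly_mulc.
    + intros x y. rewrite H. ring.
Qed.

Lemma poly_top n F : poly (S n) F ->
  exists l G, E1 l /\ poly n G /\ forall x y, F x y = (G x y + l x * Cpow y n)%C.
Proof.
  revert F; induction n; intros F HF;
    destruct (poly_S_inv _ F HF) as (c & F1 & Hc & HF1 & EF).
  - exists c, (fun _ _ => 0%C). split; [exact Hc|split].
    + apply poly_zero.
    + intros x y. rewrite EF, (poly_0_inv F1 HF1). simpl. ring.
  - destruct (IHn F1 HF1) as (l & K & Hl & HK & E).
    exists l, (fun x y => c x + y * K x y)%C. split; [exact Hl|split].
    + now apply (poly_S n c K).
    + intros x y. rewrite EF, E. simpl. ring.
Qed.

Lemma E1_poly n F h : poly n F -> E1 h -> E1 (fun x => F x (h x)).
Proof.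
  intros HF Hh. induction HF as [F H|n a G F Ha HG IH H].
  - apply (E1_pointwise (fun _ => 0%C)); [|apply E1_const]. intros x; now rewrite H.
  - apply (E1_pointwise (fun x => a x + h x * G x (h x))%C); [intros x; now rewrite H|].
    apply E1_plus; auto. now apply E1_mult.
Qed.

Lemma smooth_pointwise f g : (forall x, f x = g x) -> smooth f -> smooth g.
Proof. intros H Hf. apply (jet_ext f); auto. now apply filter_forall. Qed.

Lemma smooth_poly n F h : poly n F -> smooth h -> smooth (fun x => F x (h x)).
Proof.
  intros HF Hh. induction HF as [F H|n a G F Ha HG IH H].
  - apply (smooth_pointwise (fun _ => 0%C)); [|apply smooth_const]. intros x; now rewrite H.
  - apply (smooth_pointwise (fun x => a x + h x * G x (h x))%C); [intros x; now rewrite H|].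
    apply smooth_plus; [now apply E1_smooth|]. now apply smooth_mult.
Qed.


(** A polynomial in y that vanishes identically has zero leading coefficient d: with
    F(y) the sum below, for a G of degree n, the combination F(2y) - 2^n F(y) kills
    the highest term of G and multiplies d by a nonzero constant.  What remains of G has lower degree, so the
    gap k between it and the term in d grows. *)
Lemma poly_top_zero n : forall k G (d : C) x, poly n G ->
  (forall y, G x y + d * Cpow y (n + k) = 0)%C -> d = 0%C.
Proof.
  induction n; intros k G d x HG H.
  - specialize (H 1%C). rewrite (poly_0_inv G HG), Cpow_1_l in H.
    rewrite <- H. ring.
  - destruct (poly_top n G HG) as (l & K & Hl & HK & E).
    assert (Hd : (d * (Cpow 2 (S n + k) - Cpow 2 n))%C = 0%C).
    { apply (IHn (S k) (fun x y => K x ((fun _ => 2%C) x * y) + (fun _ => - Cpow 2 n)%C x * K x y)%C _ x).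
      - apply poly_plus.
        + apply poly_scale; auto. apply E1_const.
        + apply poly_mulc; auto. apply E1_const.
      - intros y. cbn beta. pose proof (H (2 * y)%C) as H2. pose proof (H y) as H1.
        rewrite E in H1, H2. rewrite !Cpow_mult_l in H2.
        replace (n + S k)%nat with (S n + k)%nat by lia.
        transitivity ((K x (2 * y) + l x * (Cpow 2 n * Cpow y n) + d * (Cpow 2 (S n + k) * Cpow y (S n + k)))
          - Cpow 2 n * (K x y + l x * Cpow y n + d * Cpow y (S n + k)))%C; [ring|].
        rewrite H1, H2. ring. }
    destruct (Ceq_dec d 0%C) as [|Hn]; auto. exfalso. revert Hd. apply Cmult_neq_0; auto.
    intros E2.
    assert (E3 : (2 ^ (S n + k))%R = (2 ^ n)%R).
    { apply RtoC_inj. rewrite !RtoC_pow.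
      replace (Cpow 2 (S n + k)) with (Cpow 2 (S n + k) - Cpow 2 n + Cpow 2 n)%C by ring.
      rewrite E2. ring. }
    assert (2 ^ n < 2 ^ (S n + k)) by (apply Rlt_pow; [lra|lia]). lra.
Qed.

(** F' is the derivative of F in y, characterized algebraically: at each b in the
    class the remainder of the first order expansion is z^2 times a polynomial. *)
Definition taylor (F F' : R -> C -> C) : Prop :=
  forall b, E1 b -> exists m Q, poly m Q /\
    forall x z, F x (b x + z)%C = (F x (b x) + z * F' x (b x) + z * z * Q x z)%C.


Lemma taylor_ext F G F' G' : (forall x y, F x y = G x y) -> (forall x y, F' x y = G' x y) ->
  taylor F F' -> taylor G G'.
Proof.
  intros E E' H b Hb. destruct (H b Hb) as (m & Q & HQ & HT).
  exists m, Q. split; auto. intros x z. now rewrite <- !E, <- E'.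
Qed.

Lemma taylor_cst c : taylor (fun x _ => c x) (fun _ _ => 0%C).
Proof.
  intros b Hb. exists O, (fun _ _ => 0%C). split; [apply poly_zero|]. intros; ring.
Qed.

Lemma taylor_muly n G G' : poly n G' -> taylor G G' ->
  taylor (fun x y => y * G x y)%C (fun x y => G x y + y * G' x y)%C.
Proof.
  intros HG' HT b Hb. destruct (HT b Hb) as (m & Q & HQ & E).
  exists (S m), (fun x z => (G' x (b x) + b x * Q x z) + z * Q x z)%C. split.
  - apply poly_plus; [apply poly_plus|].
    + apply (poly_weaken 1); [lia|]. apply poly_const. now apply (E1_poly n).
    + apply (poly_weaken m); [lia|]. now apply poly_mulc.
    + now apply poly_muly.
  - intros x z. rewrite E. ring.
Qed.

Lemma taylor_plus F F' G G' : taylor F F' -> taylor G G' ->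
  taylor (fun x y => F x y + G x y)%C (fun x y => F' x y + G' x y)%C.
Proof.
  intros HF HG b Hb. destruct (HF b Hb) as (m & Q & HQ & E).
  destruct (HG b Hb) as (m' & Q' & HQ' & E').
  exists (max m m'), (fun x z => Q x z + Q' x z)%C. split.
  - apply poly_plus; [apply (poly_weaken m) | apply (poly_weaken m')]; auto; lia.
  - intros x z. rewrite E, E'. ring.
Qed.

Lemma poly_taylor n F : poly n F -> exists F', poly (pred n) F' /\ taylor F F'.
Proof.
  intros HF. induction HF as [F H|n c G F Hc HG (G' & HG' & IH) H].
  - exists (fun _ _ => 0%C). split; [apply poly_zero|].
    apply (taylor_ext (fun _ _ => 0%C) _ (fun _ _ => 0%C) _); auto.
    apply (taylor_cst (fun _ => 0%C)).
  - exists (fun x y => 0 + (G x y + y * G' x y))%C. split.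
    + apply (poly_ext n (fun x y => G x y + y * G' x y)%C); [|intros; ring].
      apply poly_plus; auto. destruct n as [|n]; simpl in HG'.
      * apply poly_0. intros x y. rewrite (poly_0_inv G' HG'). ring.
      * now apply poly_muly.
    + apply (taylor_ext (fun x y => c x + y * G x y)%C _ (fun x y => 0 + (G x y + y * G' x y))%C _); auto.
      apply (taylor_plus (fun x y => c x) (fun _ _ => 0%C)); [apply taylor_cst|].
      now apply (taylor_muly (pred n)).
Qed.

Lemma taylor_monomial n l : E1 l ->
  taylor (fun x y => l x * Cpow y n)%C (fun x y => RtoC (INR n) * l x * Cpow y (pred n))%C.
Proof.
  intros Hl. induction n.
  - apply (taylor_ext (fun x y => l x) _ (fun _ _ => 0%C) _); [intros; simpl; ring|intros; simpl; ring|].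
    apply taylor_cst.
  - apply (taylor_ext (fun x y => y * (l x * Cpow y n))%C _
      (fun x y => l x * Cpow y n + y * (RtoC (INR n) * l x * Cpow y (pred n)))%C _).
    + intros; simpl; ring.
    + intros x y. rewrite S_INR, RtoC_plus. destruct n; simpl; ring.
    + apply (taylor_muly (S (pred n))); auto.
      apply (poly_monomial (pred n) (fun x => RtoC (INR n) * l x)%C).
      apply E1_mult; auto. apply E1_const.
Qed.

(** One division step multiplies F by the leading coefficient l of the divisor, since
    l need not be invertible in the class. *)
Lemma pseudo_division m l P0 : E1 l -> poly m P0 -> forall n F, poly (m + n) F ->
  exists N Q T, poly n Q /\ poly m T /\ forall x y,
    (Cpow (l x) N * F x y = Q x y * (P0 x y + l x * Cpow y m) + T x y)%C.
Proof.
  intros Hl HP. induction n; intros F HF.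
  - exists O, (fun _ _ => 0%C), F. split; [apply poly_zero|]. split.
    + now replace m with (m + 0)%nat by lia.
    + intros; simpl; ring.
  - replace (m + S n)%nat with (S (m + n)) in HF by lia.
    destruct (poly_top _ F HF) as (c & G & Hc & HG & E).
    destruct (IHn (fun x y => l x * G x y + (- (1) * c x) * (Cpow y n * P0 x y))%C)
      as (N & Q & T & HQ & HR & ED).
    { apply poly_plus; [now apply poly_mulc|].
      apply (poly_mulc _ (fun x => - (1) * c x)%C).
      - apply (E1_mult (fun _ => (- (1))%C)); auto. apply E1_const.
      - replace (m + n)%nat with (n + m)%nat by lia. now apply poly_mulyn. }
    exists (S N), (fun x y => Q x y + (Cpow (l x) N * c x) * Cpow y n)%C, T.
    split; [|split]; auto.
    + apply poly_plus; [apply (poly_weaken n); auto|].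
      apply (poly_monomial n (fun x => Cpow (l x) N * c x)%C).
      apply E1_mult; auto. now apply E1_pow.
    + intros x y. specialize (ED x y). rewrite E. rewrite Cpow_S.
      transitivity (Cpow (l x) N * (l x * G x y + - (1) * c x * (Cpow y n * P0 x y))
        + Cpow (l x) N * c x * Cpow y n * (P0 x y + l x * Cpow y m))%C.
      * rewrite Cpow_add_r. ring.
      * rewrite ED. ring.
Qed.

(** * The minimal polynomial of a smooth root *)

(** Only x <> 0 matters here, because nonzero elements of the class may vanish at 0
    but not elsewhere near 0. *)
Definition pzero (F : R -> C -> C) : Prop := locally' 0 (fun x => forall y, F x y = 0%C).

Section Annihilator.

Hypothesis M_qa : quasianalytic M.
Variable h : R -> C.
Hypothesis Hh : smooth h.

Lemma E1_flat f : E1 f -> flat_germ f -> locally 0 (fun x => f x = 0%C).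
Proof. intros H. apply M_qa. now apply class_E1_iff. Qed.

(** Flatness of F(x, h(x)), rather than its vanishing, is the right notion for the
    minimal degree: smooth germs have zero divisors, but modulo flat ones they are
    formal power series, which form a domain. *)
Definition kills (n : nat) (F : R -> C -> C) : Prop :=
  poly n F /\ ~ pzero F /\ flat_germ (fun x => F x (h x)).

Section Minimal.

Variables (m : nat) (P0 : R -> C -> C) (l : R -> C).
Let P x y := (P0 x y + l x * Cpow y m)%C.
Hypothesis Hl : E1 l.
Hypothesis HP0 : poly m P0.
Hypothesis HP : kills (S m) P.
Hypothesis Hmin : forall j F, (j <= m)%nat -> ~ kills j F.

Lemma minimal_lead : ~ flat_germ l.
Proof.
  intros Hf. apply (E1_flat l Hl) in Hf. destruct HP as (HPp & HPz & HPf).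
  apply (Hmin m P0); auto. split; [exact HP0|split].
  - intros Hz. apply HPz. unfold pzero in *. generalize (filter_and _ _ Hz (punctured_of_local _ Hf)).
    apply filter_imp; intros x [Hx1 Hx2] y. unfold P. rewrite Hx1, Hx2. ring.
  - revert HPf. apply flat_ext; [|now apply (smooth_poly (S m))].
    revert Hf; apply filter_imp; intros x Hx. unfold P. rewrite Hx. ring.
Qed.

Lemma minimal_lead_nz : locally' 0 (fun x => l x <> 0%C).
Proof. apply nonflat_nonzero; [now apply E1_smooth | apply minimal_lead]. Qed.

Lemma minimal_degree : m <> O.
Proof.
  intros Hm. apply minimal_lead. destruct HP as (_ & _ & HPf).
  revert HPf. apply flat_ext.
  - apply filter_forall; intros x. unfold P.
    assert (E : P0 x (h x) = 0%C) by (apply poly_0_inv; rewrite <- Hm; exact HP0).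
    rewrite E, Hm. simpl. ring.
  - apply (smooth_poly (S m)); auto. apply HP.
Qed.

Lemma minimal_flat j F : (j <= m)%nat -> poly j F -> flat_germ (fun x => F x (h x)) -> pzero F.
Proof.
  intros Hj HF Hf. apply NNPP. intros Hz. now apply (Hmin j F).
Qed.

(** Were P_y(x, h) flat, minimality would make P_y zero as a polynomial, against its
    leading coefficient m l. *)
Lemma minimal_derivative : exists P', poly m P' /\ taylor P P' /\
  ~ flat_germ (fun x => P' x (h x)).
Proof.
  pose proof minimal_degree as Hm.
  destruct (poly_taylor m P0 HP0) as (P0' & HP0' & HT).
  exists (fun x y => P0' x y + RtoC (INR m) * l x * Cpow y (pred m))%C.
  assert (Hp : poly m (fun x y => P0' x y + RtoC (INR m) * l x * Cpow y (pred m))%C).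
  { apply poly_plus; [apply (poly_weaken (pred m)); auto; lia|].
    replace m with (S (pred m)) at 1 by lia.
    apply (poly_monomial (pred m) (fun x => RtoC (INR m) * l x)%C).
    apply E1_mult; auto. apply E1_const. }
  split; [exact Hp|]. split.
  - unfold P. apply taylor_plus; auto. now apply taylor_monomial.
  - intros Hf. apply (minimal_flat m _ (le_n m) Hp) in Hf. unfold pzero in Hf.
    destruct (punctured_nonempty _ (filter_and _ _ Hf minimal_lead_nz)) as (x & Hx & Hlx).
    assert (E : (RtoC (INR m) * l x)%C = 0%C).
    { apply (poly_top_zero (pred m) 0 P0' _ x HP0'). intros y.
      rewrite Nat.add_0_r. apply Hx. }
    revert E. apply Cmult_neq_0; auto. intros E. apply RtoC_inj in E.
    now apply (not_0_INR m).
Qed.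

(** Dividing F by P: the remainder has lower degree and is flat along h, hence zero,
    so l^N F = Q P.  The degree drops while the exponent i of P grows, until F is not
    flat along h; then F(x, h(x)) <> 0 off the origin and P(x, h(x)) must vanish. *)
Lemma minimal_root : forall n F i, poly n F -> ~ pzero F ->
  locally 0 (fun x => F x (h x) * Cpow (P x (h x)) i = 0)%C ->
  locally' 0 (fun x => P x (h x) = 0%C).
Proof.
  destruct HP as (HPp & HPz & HPf).
  intros n. induction (Wf_nat.lt_wf n) as [n _ IH]. intros F i HF HFz H.
  assert (HFs : smooth (fun x => F x (h x))) by now apply (smooth_poly n).
  assert (HPs : smooth (fun x => P x (h x))) by now apply (smooth_poly (S m)).
  destruct (classic (flat_germ (fun x => F x (h x)))) as [Hf|Hf].
  - assert (Hn : (m < n)%nat).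
    { destruct (Nat.le_gt_cases n m) as [Hn|]; auto. exfalso.
      apply HFz. now apply (minimal_flat n). }
    destruct (pseudo_division m l P0 Hl HP0 (n - m) F) as (N & Q & T & HQ & HR & E).
    { now replace (m + (n - m))%nat with n by lia. }
    assert (HlN : smooth (fun x => Cpow (l x) N)) by (apply smooth_pow; now apply E1_smooth).
    assert (HRz : pzero T).
    { apply (minimal_flat m); auto.
      assert (HQs : smooth (fun x => - (1) * Q x (h x))%C).
      { apply smooth_mult; [apply smooth_const|]. now apply (smooth_poly (n - m)). }
      apply (flat_ext (fun x => Cpow (l x) N * F x (h x) + (- (1) * Q x (h x)) * P x (h x))%C).
      - apply filter_forall; intros x. rewrite E. unfold P. ring.
      - apply smooth_plus; apply smooth_mult; auto.
      - apply flat_plus; try (apply smooth_mult; auto); now apply flat_mult. }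
    pose proof minimal_degree as Hm.
    apply (IH (n - m)%nat ltac:(lia) Q (S i)); auto.
    + intros HQz. apply HFz. unfold pzero in *. generalize (filter_and _ _ HQz (filter_and _ _ HRz minimal_lead_nz)).
      apply filter_imp; intros x (H1 & H2 & H3) y.
      specialize (E x y). rewrite H1, H2 in E.
      destruct (Ceq_dec (F x y) 0%C) as [|Hn0]; auto. exfalso.
      apply (Cmult_neq_0 (Cpow (l x) N) (F x y)); auto; [now apply Cpow_nz|].
      rewrite E. ring.
    + apply smooth_eq_punctured; [|apply smooth_const|].
      { apply smooth_mult; [now apply (smooth_poly (n - m))|].
        now apply (smooth_pow (fun x => P x (h x))). }
      unfold pzero in HRz. generalize (filter_and _ _ HRz (punctured_of_local _ H)).
      apply filter_imp; intros x (H1 & H2).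
      specialize (E x (h x)). rewrite H1 in E. fold (P x (h x)) in E. rewrite Cpow_S.
      transitivity (Cpow (l x) N * (F x (h x) * Cpow (P x (h x)) i))%C; [|rewrite H2; ring].
      rewrite !Cmult_assoc, E. ring.
  - generalize (filter_and _ _ (nonflat_nonzero _ HFs Hf) (punctured_of_local _ H)).
    apply filter_imp; intros x (H1 & H2).
    destruct (Ceq_dec (P x (h x)) 0%C) as [|Hn0]; auto. exfalso.
    revert H2. apply Cmult_neq_0; auto. now apply Cpow_nz.
Qed.

End Minimal.

Lemma separable_annihilator n F : poly n F -> ~ pzero F ->
  locally 0 (fun x => F x (h x) = 0%C) ->
  exists m P P', poly m P /\ poly m P' /\ taylor P P' /\
    locally' 0 (fun x => P x (h x) = 0%C) /\ ~ flat_germ (fun x => P' x (h x)).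
Proof.
  intros HF HFz H.
  assert (Hex : exists k, (exists G, kills k G) /\ forall j, (j < k)%nat -> ~ exists G, kills j G).
  { assert (Hk : exists G, kills n G).
    { exists F. split; [exact HF|split; [exact HFz|]]. now apply flat_zero. }
    revert Hk. generalize n. intros k. induction (Wf_nat.lt_wf k) as [k _ IH]. intros Hk.
    destruct (classic (exists j, (j < k)%nat /\ exists G, kills j G)) as [(j & Hj & Hj')|Hno].
    - now apply (IH j).
    - exists k. split; auto. intros j Hj HG. apply Hno. eauto. }
  destruct Hex as (k & (P & HP) & Hmin).
  destruct k as [|m].
  { exfalso. destruct HP as (HP & HPz & _). apply HPz. unfold pzero, locally', within.
    apply filter_forall; intros x _ y. now apply poly_0_inv. }
  destruct (poly_top m P (proj1 HP)) as (l & P0 & Hl & HP0 & E).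
  assert (HP' : kills (S m) (fun x y => P0 x y + l x * Cpow y m)%C).
  { destruct HP as (H1 & H2 & H3). split; [|split].
    - now apply (poly_ext (S m) P).
    - intros Hz; apply H2. revert Hz; unfold pzero; apply filter_imp; intros x Hx y. now rewrite E.
    - revert H3. apply flat_ext; [now apply filter_forall | now apply (smooth_poly (S m))]. }
  assert (Hmin' : forall j G, (j <= m)%nat -> ~ kills j G).
  { intros j G Hj HG. apply (Hmin j); [lia|]. eauto. }
  destruct (minimal_derivative m P0 l Hl HP0 HP' Hmin') as (P' & Hp' & HT & Hn).
  exists (S m), (fun x y => P0 x y + l x * Cpow y m)%C, P'.
  split; [apply HP'|]. split; [apply (poly_weaken m); auto|].
  split; [exact HT|]. split; [|exact Hn].
  apply (minimal_root m P0 l Hl HP0 HP' Hmin' n F O); auto.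
  revert H; apply filter_imp; intros x Hx. rewrite Hx. ring.
Qed.

End Annihilator.

(** * Equations in fixed-point form *)

Lemma wnorm_0 N a : wnorm 0 N a = Cmod (a O).
Proof.
  unfold wnorm. induction N; simpl.
  - rewrite M_0. field.
  - rewrite IHN. ring.
Qed.

Lemma wnorm_continuous N a : continuity (fun rho => wnorm rho N a).
Proof. apply continuity_finite_sum. Qed.

(** The majorant Psi is a polynomial with nonnegative coefficients, bounds for the
    norms of the coefficients of F; it depends neither on x, nor on rho, nor on N. *)
Lemma poly_majorant n F w : poly n F -> smooth w ->
  exists rho0 Psi, 0 < rho0 /\
    (forall s t, 0 <= s <= t -> 0 <= Psi s <= Psi t) /\
    locally 0 (fun x => forall rho N, 0 <= rho <= rho0 ->
      wnorm rho N (fun i => jet (fun x => F x (w x)) i x) <= Psi (wnorm rho N (fun i => jet w i x))).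
Proof.
  intros HF Hw. induction HF as [F H|n c G F Hc HG IH H].
  - exists 1, (fun _ => 0). split; [lra|]. split; [intros; lra|].
    destruct (jet_const 0%C) as [Hs Hj].
    destruct (jet_ext (fun _ => 0%C) (fun x => F x (w x))) as [_ Hj']; auto.
    { now apply filter_forall. }
    generalize (filter_and _ _ Hj Hj'); apply filter_imp; intros x [e1 e2] rho N Hr.
    rewrite (wnorm_ext _ _ _ (const_jet 0%C)).
    + rewrite wnorm_const, Cmod_0; lra.
    + intros i. now rewrite e2, e1.
  - destruct IH as (r1 & Psi & Hr1 & HPsi & IH).
    destruct Hc as [Hc (r2 & B & Hr2 & HB)].
    exists (Rmin r1 r2), (fun s => Rabs B + s * Psi s).
    split; [now apply Rmin_pos|]. split.
    { intros s t Hst. pose proof (HPsi s t Hst). pose proof (Rabs_pos B). split; nra. }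
    assert (HGs : smooth (fun x => G x (w x))) by now apply (smooth_poly n).
    destruct (jet_mult w _ Hw HGs) as [Hm Hmj].
    destruct (jet_plus c _ Hc Hm) as [Hp Hpj].
    destruct (jet_ext (fun x => c x + w x * G x (w x))%C (fun x => F x (w x))) as [_ Hj']; auto.
    { now apply filter_forall. }
    generalize (filter_and _ _ (filter_and _ _ Hmj Hpj) (filter_and _ _ Hj' (filter_and _ _ IH HB))).
    apply filter_imp; intros x ((e1 & e2) & e3 & H4 & H5) rho N Hr.
    pose proof (Rmin_l r1 r2). pose proof (Rmin_r r1 r2).
    rewrite (wnorm_ext _ _ _ (fun i => jet c i x +
      conv (fun i => jet w i x) (fun i => jet (fun x => G x (w x)) i x) i)%C).
    2:{ intros i. now rewrite e3, e2, e1. }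
    eapply Rle_trans; [apply wnorm_plus; lra|]. apply Rplus_le_compat.
    + eapply Rle_trans; [apply (wnorm_mono rho r2); lra|].
      eapply Rle_trans; [apply H5|]. apply Rle_abs.
    + eapply Rle_trans; [apply wnorm_conv; lra|].
      apply Rmult_le_compat_l; [apply wnorm_nonneg; lra|]. apply H4; lra.
Qed.

(** Continuity argument in rho for each fixed x and N.  At rho = 0 the norm of the
    jet of w is |w(x)| < K = |c| + 1.  It cannot equal K for any rho <= rho1, because
    then K <= |c| + (|x| + rho) Psi(K) < |c| + 1. *)
Lemma E1_fixed_point n F c w : poly n F -> smooth w ->
  locally 0 (fun x => w x = c + RtoC x * F x (w x))%C -> E1 w.
Proof.
  intros HF Hw H. split; [exact Hw|].
  assert (Hwc : w 0 = c).
  { pose proof (locally_singleton _ _ H) as E. cbn beta in E. rewrite E. ring. }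
  destruct (poly_majorant n F w HF Hw) as (rho0 & Psi & Hrho0 & HPsi & HM).
  set (K := Cmod c + 1). pose proof (Cmod_ge_0 c) as Hc0.
  assert (HK : 0 <= Psi K) by (apply (HPsi K K); unfold K; lra).
  (* Chosen so that |x| < e and rho <= e give (|x| + rho) Psi K < 1. *)
  set (e := / (2 * (Psi K + 1))).
  assert (He : 0 < e) by (apply Rinv_0_lt_compat; lra).
  assert (HeK : 2 * e * Psi K < 1).
  { unfold e. replace (2 * / (2 * (Psi K + 1)) * Psi K) with (1 - / (Psi K + 1)) by (field; lra).
    assert (0 < / (Psi K + 1)) by (apply Rinv_0_lt_compat; lra). lra. }
  set (rho1 := Rmin rho0 e).
  assert (Hrho1 : 0 < rho1) by now apply Rmin_pos.
  pose proof (Rmin_l rho0 e) as Hl. pose proof (Rmin_r rho0 e) as Hr. fold rho1 in Hl, Hr.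
  exists rho1, K. split; [exact Hrho1|].
  assert (HFs : smooth (fun x => F x (w x))) by now apply (smooth_poly n).
  destruct jet_id as [Hi Hij]. destruct (jet_const c) as [Hcs Hcj].
  destruct (jet_mult _ _ Hi HFs) as [Hm Hmj].
  destruct (jet_plus _ _ Hcs Hm) as [Hp Hpj].
  destruct (jet_ext (fun x => c + RtoC x * F x (w x))%C w) as [_ Hj]; auto.
  { revert H; apply filter_imp; auto. }
  assert (Hx : locally 0 (fun x => Rabs x < e)) by (apply (radius_locally _ e); auto).
  assert (Hw1 : locally 0 (fun x => Cmod (w x - w 0)%C < 1)) by (apply smooth_continuous; auto; lra).
  generalize (filter_and _ _ (filter_and _ _ Hij Hcj) (filter_and _ _ (filter_and _ _ Hmj Hpj)
    (filter_and _ _ (filter_and _ _ Hj HM) (filter_and _ _ Hx Hw1)))).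
  unfold wnorm_bounded. apply filter_imp.
  intros x ((e1 & e2) & (e3 & e4) & (e5 & HMx) & Hxe & Hwx) N.
  assert (Hineq : forall rho, 0 <= rho <= rho1 ->
    wnorm rho N (fun i => jet w i x) <= Cmod c + (Rabs x + rho) * Psi (wnorm rho N (fun i => jet w i x))).
  { intros rho Hrho.
    rewrite (wnorm_ext _ _ _ (fun i => const_jet c i +
      conv (id_jet x) (fun i => jet (fun x => F x (w x)) i x) i)%C) at 1.
    2:{ intros i. rewrite e5, e4, e2, e3. f_equal.
        apply conv_ext_l. exact e1. }
    eapply Rle_trans; [apply wnorm_plus; lra|]. rewrite wnorm_const by lra.
    apply Rplus_le_compat_l.
    eapply Rle_trans; [apply wnorm_conv; lra|].
    apply Rmult_le_compat; try (apply wnorm_nonneg; lra).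
    - apply wnorm_id; lra.
    - apply HMx; lra. }
  destruct (Rle_or_lt (wnorm rho1 N (fun i => jet w i x)) K) as [|Hgt]; auto. exfalso.
  assert (H0 : wnorm 0 N (fun i => jet w i x) < K).
  { rewrite wnorm_0, jet_0. unfold K. rewrite Hwc in Hwx.
    replace (w x) with (w x - c + c)%C by ring.
    eapply Rle_lt_trans; [apply Cmod_triangle|]. lra. }
  destruct (IVT (fun rho => wnorm rho N (fun i => jet w i x) - K) 0 rho1) as (z & Hz & Ez).
  - apply (continuity_minus (fun rho => wnorm rho N (fun i => jet w i x)) (fun _ => K)).
    + apply wnorm_continuous.
    + apply continuity_const. now intros u v.
  - exact Hrho1.
  - lra.
  - lra.
  - assert (EK : wnorm z N (fun i => jet w i x) = K) by lra.
    specialize (Hineq z Hz). rewrite EK in Hineq. unfold K at 1 in Hineq.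
    pose proof (Rabs_pos x).
    assert ((Rabs x + z) * Psi K <= 2 * e * Psi K) by (apply Rmult_le_compat_r; lra).
    lra.
Qed.

(** * Roots of finite order *)

Section Stable.

Hypothesis M_stable : stable_under_derivation M.

Lemma E1_hadamard f : E1 f -> exists g, E1 g /\ locally 0 (fun x => f x = f 0 + RtoC x * g x)%C.
Proof.
  intros Hf. apply class_E1_iff in Hf.
  destruct (class_E1_hadamard M f M_stable Hf) as (g & Hg & E).
  exists g. split; auto. now apply class_E1_iff.
Qed.

Lemma E1_divide k g : smooth g -> E1 (fun x => Cpow (RtoC x) k * g x)%C -> E1 g.
Proof.
  intros Hg. induction k; intros H.
  - revert H. apply E1_pointwise. intros x. simpl. ring.
  - apply IHk. destruct (E1_hadamard _ H) as (q & Hq & E).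
    apply (E1_ext q); [|exact Hq]. apply smooth_eq_punctured.
    + now apply E1_smooth.
    + apply smooth_mult; auto. apply smooth_pow. apply jet_id.
    + generalize (filter_and _ _ punctured_neq0 (punctured_of_local _ E)).
      apply filter_imp; intros x [Hx Ex]. simpl in Ex.
      replace (q x) with (/ RtoC x * (RtoC x * q x))%C by (field; auto).
      replace (RtoC x * q x)%C with (RtoC x * Cpow (RtoC x) k * g x)%C; [field; auto|].
      rewrite Ex. ring.
Qed.

(** p is a Taylor polynomial of f, which the class contains together with all
    polynomials in x. *)
Lemma smooth_jet_split k f : smooth f ->
  exists p u, E1 p /\ smooth u /\ locally 0 (fun x => f x = p x + Cpow (RtoC x) k * u x)%C.
Proof.
  revert f; induction k; intros f Hf.
  - exists (fun _ => 0%C), f. split; [apply E1_const|]. split; [exact Hf|].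
    apply filter_forall; intros x. simpl. ring.
  - destruct (smooth_hadamard f Hf) as (g & Hg & E & _).
    destruct (IHk g Hg) as (p & u & Hp & Hu & E2).
    exists (fun x => f 0 + RtoC x * p x)%C, u. split; [|split; [exact Hu|]].
    + apply E1_plus; [apply E1_const|]. apply E1_mult; auto. apply E1_id.
    + generalize (filter_and _ _ E E2). apply filter_imp; intros x [-> ->]. simpl. ring.
Qed.

(** Newton-Tougeron substitution h = p + x^(k+1) w, where k is the order of
    P_y(x, h(x)).  With z = x^(k+1) w, the expansion
      0 = P(x, p) + z P_y(x, p) + z^2 Q(x, z)
    is x^(2k+1) times c + w v + x w^2 Q(x, z), where P_y(x, p) = x^k v
    and P(x, p) = x^(2k+1) c; v(0) <> 0 because P_y(x, p) and P_y(x, h) agree up to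
    order k. *)
Lemma E1_simple_root m P P' h : poly m P -> poly m P' -> taylor P P' -> smooth h ->
  locally' 0 (fun x => P x (h x) = 0%C) -> ~ flat_germ (fun x => P' x (h x)) -> E1 h.
Proof.
  intros HP HP' HT Hh Hroot Hn.
  destruct (nonflat_order _ (smooth_poly m P' h HP' Hh) Hn) as (k & u & Hu & Hu0 & Eu).
  destruct (smooth_jet_split (S k) h Hh) as (p & w & Hp & Hw & Eh).
  destruct (HT p Hp) as (m1 & Q & HQ & EQ).
  destruct (poly_taylor m P' HP') as (P'' & HP'' & HT').
  destruct (HT' p Hp) as (m2 & Q' & HQ' & EQ').
  assert (Hx : smooth RtoC) by apply jet_id.
  assert (HX : E1 (fun x => Cpow (RtoC x) (S k))) by (apply E1_pow, E1_id).
  set (z := fun x => (Cpow (RtoC x) (S k) * w x)%C).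
  assert (Hz : smooth z) by (apply smooth_mult; auto; now apply E1_smooth).
  assert (HQz : smooth (fun x => Q x (z x))) by now apply (smooth_poly m1).
  set (v := fun x => (u x + - (1) * (RtoC x * (w x * (P'' x (p x) + z x * Q' x (z x)))))%C).
  assert (Hv : smooth v).
  { unfold v. apply smooth_plus; auto. apply smooth_mult; [apply smooth_const|].
    apply smooth_mult; auto. apply smooth_mult; auto. apply smooth_plus.
    - apply (smooth_poly (pred m)); auto. now apply E1_smooth.
    - apply smooth_mult; auto. now apply (smooth_poly m2). }
  assert (Ev : locally 0 (fun x => P' x (p x) = Cpow (RtoC x) k * v x)%C).
  { generalize (filter_and _ _ Eu Eh). apply filter_imp; intros x [e1 e2].
    rewrite e2 in e1. fold (z x) in e1. rewrite EQ' in e1. unfold v.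
    transitivity (P' x (p x) + z x * P'' x (p x) + z x * z x * Q' x (z x)
      - z x * (P'' x (p x) + z x * Q' x (z x)))%C; [ring|].
    rewrite e1. unfold z at 1. simpl. ring. }
  assert (Hv1 : E1 v).
  { apply (E1_divide k); auto. eapply E1_ext; [exact Ev|].
    now apply (E1_poly m). }
  set (c := fun x => (- (1) * (w x * v x + RtoC x * (w x * w x * Q x (z x))))%C).
  assert (Hc : smooth c).
  { unfold c. apply smooth_mult; [apply smooth_const|]. apply smooth_plus.
    - now apply smooth_mult.
    - apply smooth_mult; auto. apply smooth_mult; auto. now apply smooth_mult. }
  assert (Hpp : E1 (fun x => P x (p x))) by now apply (E1_poly m).
  assert (Ec : locally 0 (fun x => P x (p x) = Cpow (RtoC x) (S k + k) * c x)%C).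
  { apply smooth_eq_punctured.
    - now apply E1_smooth.
    - apply smooth_mult; auto. now apply smooth_pow.
    - generalize (filter_and _ _ Hroot (punctured_of_local _ (filter_and _ _ Eh Ev))).
      apply filter_imp; intros x (H1 & H2 & H3).
      rewrite H2 in H1. fold (z x) in H1. rewrite EQ, H3 in H1. unfold c.
      transitivity (P x (p x) + z x * (Cpow (RtoC x) k * v x) + z x * z x * Q x (z x)
        - (z x * (Cpow (RtoC x) k * v x) + z x * z x * Q x (z x)))%C; [ring|].
      rewrite H1. rewrite Cpow_add_r. unfold z at 1 2 3. simpl. ring. }
  assert (Hc1 : E1 c).
  { apply (E1_divide (S k + k)); auto. eapply E1_ext; [exact Ec|]. exact Hpp. }
  assert (Hv0 : v 0 <> 0%C).
  { unfold v. replace (u 0 + _)%C with (u 0) by ring. exact Hu0. }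
  (* Splitting off v(0) and c(0) puts every other term of c + v w + x w^2 Q = 0 under
     a factor x, and only the constant v(0) has to be inverted. *)
  destruct (E1_hadamard v Hv1) as (v1 & Hv1' & Ev1).
  destruct (E1_hadamard c Hc1) as (c1 & Hc1' & Ec1).
  set (F := fun x y => (- / v 0 * (c1 x + (v1 x * y + y * (y * Q x (Cpow (RtoC x) (S k) * y)))))%C).
  assert (HF : poly (S (S (S m1))) F).
  { unfold F. apply (poly_mulc _ (fun _ => - / v 0)%C); [apply E1_const|].
    apply poly_plus; [|apply poly_plus].
    - apply (poly_weaken 1); [lia|]. now apply poly_const.
    - apply (poly_weaken 2); [lia|].
      apply (poly_ext _ (fun x y => v1 x * Cpow y 1)%C); [now apply poly_monomial|].
      intros; simpl; ring.
    - apply (poly_weaken (S (S m1))); [lia|].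
      apply (poly_muly (S m1) (fun x y => y * Q x (Cpow (RtoC x) (S k) * y))%C).
      apply (poly_muly m1 (fun x y => Q x (Cpow (RtoC x) (S k) * y))%C).
      now apply (poly_scale m1 (fun x => Cpow (RtoC x) (S k))). }
  assert (Ew : E1 w).
  { apply (E1_fixed_point _ F (- / v 0 * c 0)%C w HF Hw).
    generalize (filter_and _ _ Ev1 Ec1). apply filter_imp; intros x [H1 H2].
    assert (Hcx : c x = (- (1) * (w x * v x + RtoC x * (w x * w x * Q x (z x))))%C) by reflexivity.
    rewrite H2, H1 in Hcx. unfold F. fold (z x).
    transitivity (/ v 0 * (v 0 * w x))%C; [field; auto|].
    replace (v 0 * w x)%C with
      (- (- (1) * (w x * (v 0 + RtoC x * v1 x) + RtoC x * (w x * w x * Q x (z x))))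
       - RtoC x * (v1 x * w x + w x * w x * Q x (z x)))%C by ring.
    rewrite <- Hcx. ring. }
  apply (E1_ext (fun x => p x + Cpow (RtoC x) (S k) * w x)%C).
  - revert Eh; apply filter_imp; auto.
  - apply E1_plus; auto. now apply E1_mult.
Qed.

End Stable.

(** * Smooth roots of monic polynomials *)

Lemma poly_monic d a : (forall j, (1 <= j <= d)%nat -> E1 (a j)) ->
  exists G, poly d G /\ forall x y, monic_poly d a x y = (G x y + 1 * Cpow y d)%C.
Proof.
  intros Ha.
  assert (H : forall k, (k <= d)%nat ->
    poly d (fun x y => sum_n_m (fun j => a j x * Cpow y (d - j))%C 1 k)).
  { induction k; intros Hk.
    - apply (poly_ext d (fun _ _ => 0%C)); [apply poly_zero|].
      intros x y. rewrite sum_n_m_zero; [reflexivity|lia].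
    - apply (poly_ext d (fun x y => sum_n_m (fun j => a j x * Cpow y (d - j)) 1 k
        + a (S k) x * Cpow y (d - S k))%C).
      + apply poly_plus; [apply IHk; lia|].
        apply (poly_weaken (S (d - S k))); [lia|].
        apply poly_monomial, Ha. lia.
      + intros x y. rewrite sum_n_Sm; [reflexivity|lia]. }
  exists (fun x y => sum_n_m (fun j => a j x * Cpow y (d - j))%C 1 d).
  split; [now apply H|].
  intros x y. unfold monic_poly. ring.
Qed.

Lemma E1_monic_root d a h : quasianalytic M -> stable_under_derivation M ->
  (forall j, (1 <= j <= d)%nat -> E1 (a j)) -> smooth h ->
  locally 0 (fun x => monic_poly d a x (h x) = 0%C) -> E1 h.
Proof.
  intros Hqa Hst Ha Hh Hroot.
  destruct (poly_monic d a Ha) as (G & HG & EG).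
  assert (HF : poly (S d) (fun x y => G x y + 1 * Cpow y d)%C).
  { apply poly_plus; [apply (poly_weaken d); auto|].
    apply (poly_monomial d (fun _ => 1%C)), E1_const. }
  assert (HFz : ~ pzero (fun x y => G x y + 1 * Cpow y d)%C).
  { intros Hz. destruct (punctured_nonempty _ Hz) as [x Hx].
    apply C1_nz. apply (poly_top_zero d 0 G 1%C x HG).
    intros y. rewrite Nat.add_0_r. apply Hx. }
  destruct (separable_annihilator Hqa h Hh _ _ HF HFz)
    as (m & P & P' & HP & HP' & HT & HPr & HPn).
  { revert Hroot. apply filter_imp; intros x Hx. now rewrite <- EG. }
  now apply (E1_simple_root Hst m P P').
Qed.

End Class.

Theorem theorem2 :
  forall (M : nat -> R),
    increasing_seq M -> M 0%nat = 1 -> log_convex M ->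
    quasianalytic M -> stable_under_derivation M ->
  forall (d : nat) (a : nat -> R -> C),
    (1 <= d)%nat ->
    (forall j : nat, (1 <= j <= d)%nat -> class_E1 M (a j)) ->
  forall (h : R -> C),
    smooth_germ h ->
    germ_eq (fun x => monic_poly d a x (h x)) (fun _ => RtoC 0) ->
    class_E1 M h.
Proof.
  intros M Hincr H0 Hlc Hqa Hst d a _ Ha h Hh Hroot.
  apply class_E1_iff; auto.
  apply (E1_monic_root M Hincr H0 Hlc d a); auto.
  - intros j Hj. apply class_E1_iff; auto.
  - now apply smooth_germ_iff.
Qed.
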